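(* Let $X$ be a projective toric variety which is general, in the sense that no two distinct edges of the polytope $P_A\subset M_{\mathbb R}$ associated to an ample line bundle $A$ on $X$ are parallel. Then there is a constant $N$, depending only on $X$, such that for every pair of nef line bundles $L_1,L_2$ on $X$ the multiplication map $$\Phi_{L_1,L_2}: H^0(X,L_1)\otimes H^0(X,L_2)\to H^0(X,L_1\otimes L_2)$$ satisfies $\dim\operatorname{coker}\Phi_{L_1,L_2}\le N$.
   Context: Toric varieties are normal and taken over a fixed algebraically closed field. $M$ is the character lattice of the torus and $M_{\mathbb R}=M\otimes\mathbb R$. For a nef line bundle $L$ on $X$, $P_L\subset M_{\mathbb R}$ is the associated lattice polytope, defined up to translation by $M$; the lattice points of $P_L$ form a basis of $H^0(X,L)$, so $\dim\operatorname{coker}\Phi_{L_1,L_2}$ is the number of points of $P_{L_1\otimes L_2}\cap M$ not of the form $m_1+m_2$ with $m_i\in P_{L_i}\cap M$ (for compatible choices with $P_{L_1\otimes L_2}=P_{L_1}+P_{L_2}$). The condition of being general does not depend on the choice of the ample line bundle, since the edge directions are determined by the fan of $X$. *)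

(* Defs.v *)
From HB Require Import structures.
From mathcomp Require Import all_boot all_order all_algebra.
From mathcomp Require Import boolp classical_sets functions cardinality fsbigop.
From mathcomp Require Import reals.

Set Implicit Arguments.
Unset Strict Implicit.
Unset Printing Implicit Defensive.

Import Order.TTheory GRing.Theory Num.Theory.
Local Open Scope classical_set_scope.
Local Open Scope ring_scope.

(* N = M = Z^n is ['rV[int]_n], N_R = M_R = R^n is ['rV[R]_n], paired by [dot].
   A normal toric variety over k with torus T = Spec k[M] is given by its fan
   X in N_R: it is glued from the charts U_sigma = Spec k[sigma^vee /\ M],
   sigma in X, along their common open subsets. *)

Section Fans.
Variables (R : realType) (n : nat).
Implicit Types (s t : set 'rV[R]_n) (m u : 'rV[R]_n).

Definition dot m u : R := \sum_(j < n) m 0 j * u 0 j.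

Definition toR (m : 'rV[int]_n) : 'rV[R]_n := map_mx (fun z : int => z%:~R) m.

Definition cone_gen (g : seq 'rV[int]_n) : set 'rV[R]_n :=
  [set u | exists c : 'I_(size g) -> R,
     (forall i, 0 <= c i) /\ u = \sum_(i < size g) c i *: toR g`_i].

Definition rational_cone s := exists g, s = cone_gen g.

Definition strongly_convex s := forall u, s u -> s (- u) -> u = 0.

Definition dual_cone s : set 'rV[R]_n :=
  [set m | forall u, s u -> 0 <= dot m u].

Definition orth s : set 'rV[R]_n := [set m | forall u, s u -> dot m u = 0].

Definition cone_face t s :=
  exists2 m, dual_cone s m & t = s `&` [set u | dot m u = 0].

Record fan := Fan {
  cones :> set 'rV[R]_n -> Prop;
  fan_finite : finite_set cones;
  fan_rational : forall s, cones s -> rational_cone s;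
  fan_strongly_convex : forall s, cones s -> strongly_convex s;
  fan_face : forall s t, cones s -> cone_face t s -> cones t;
  fan_inter : forall s s', cones s -> cones s' ->
    cone_face (s `&` s') s /\ cone_face (s `&` s') s'
}.

Definition complete_fan (X : fan) := forall u, exists2 s, X s & s u.

Definition maximal_cone (X : fan) s :=
  X s /\ forall s', X s' -> s `<=` s' -> s' = s.

End Fans.

Section LineBundles.
Variables (R : realType) (n : nat) (X : fan R n).

(* Cartier data of a torus-invariant Cartier divisor D; every line bundle on a
   toric variety is isomorphic to some O(D).  On U_sigma, O(D) is generated by
   the character chi^(loc sigma).  Only the values of [loc] on cones of X
   matter. *)
Record line_bundle := LineBundle {
  loc :> set 'rV[R]_n -> 'rV[int]_n;
  loc_compat : forall s t, X s -> X t -> t `<=` s ->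
    forall u, t u -> dot (toR R (loc s)) u = dot (toR R (loc t)) u
}.

Fact tensor_compat (L1 L2 : line_bundle) s t : X s -> X t -> t `<=` s ->
  forall u, t u ->
  dot (toR R (L1 s + L2 s)) u = dot (toR R (L1 t + L2 t)) u.
Proof.
have dotD (a b : 'rV[int]_n) u :
    dot (toR R (a + b)) u = dot (toR R a) u + dot (toR R b) u.
  rewrite -big_split; apply: eq_bigr => j _ /=.
  by rewrite !mxE intrD mulrDl.
move=> Xs Xt ts u tu; rewrite !dotD.
by rewrite (loc_compat L1 Xs Xt ts tu) (loc_compat L2 Xs Xt ts tu).
Qed.

Definition tensor (L1 L2 : line_bundle) : line_bundle :=
  LineBundle (tensor_compat L1 L2).

Fact structure_compat s t : X s -> X t -> t `<=` s ->
  forall u, t u ->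
  dot (toR R (0 : 'rV[int]_n)) u = dot (toR R (0 : 'rV[int]_n)) u.
Proof. by []. Qed.

Definition structure_sheaf : line_bundle :=
  @LineBundle (fun=> 0) structure_compat.

Definition tensor_pow (L : line_bundle) (r : nat) : line_bundle :=
  iter r (tensor L) structure_sheaf.

Definition polytope (L : line_bundle) : set 'rV[R]_n :=
  [set m | forall s, X s -> dual_cone s (m - toR R (L s))].

End LineBundles.

(* Elements of k[M]: finitely supported functions f on M, standing for
   \sum_m f m * chi^m. *)
Section Laurent.
Variables (k : fieldType) (n : nat).
Notation M := 'rV[int]_n.

Definition laurent (f : M -> k) := finite_set [set m | f m != 0].

Definition chi (m : M) : M -> k := fun m' => (m' == m)%:R.

Definition lmul (f g : M -> k) : M -> k :=
  fun m => \sum_(a \in [set: M]) f a * g (m - a).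

Definition subalgebra_gen (A : set (M -> k)) : set (M -> k) :=
  [set f | forall B : set (M -> k), A `<=` B -> B (chi 0) ->
     (forall (c : k) g h, B g -> B h -> B (fun m => c * g m + h m)) ->
     (forall g h, B g -> B h -> B (lmul g h)) -> B f].

End Laurent.

Section Sections.
Variables (R : realType) (k : closedFieldType) (n : nat) (X : fan R n).
Notation M := 'rV[int]_n.

(* L(U_sigma) = chi^(loc sigma) * k[sigma^vee /\ M], as a subspace of k[M] *)
Definition chart_sections (L : line_bundle X) (s : set 'rV[R]_n) :
    set (M -> k) :=
  [set f | laurent f /\
     forall m, f m != 0 -> dual_cone s (toR R (m - L s))].

Definition H0 (L : line_bundle X) : set (M -> k) :=
  [set f | laurent f /\ forall s, X s -> chart_sections L s f].

(* The image of Phi_{L1,L2}: finite sums of products of sections. *)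
Definition mult_image (L1 L2 : line_bundle X) : set (M -> k) :=
  [set f | exists (r : nat) (g h : 'I_r -> M -> k),
     [/\ forall j, H0 L1 (g j), forall j, H0 L2 (h j) &
         forall m, f m = \sum_(j < r) lmul (g j) (h j) m]].

(* dim coker Phi_{L1,L2} <= d: the quotient of H^0(L1 * L2) by the image is
   spanned by the classes of d elements. *)
Definition dim_coker_le (L1 L2 : line_bundle X) (d : nat) :=
  exists2 b : 'I_d -> M -> k, (forall i, H0 (tensor L1 L2) (b i)) &
    forall f, H0 (tensor L1 L2) f ->
      exists c : 'I_d -> k,
        mult_image L1 L2 (fun m => f m - \sum_(i < d) c i * b i m).

(* For X complete.  The map given by |L| is a closed immersion iff, for each
   maximal sigma (i.e. at each torus-fixed point), |L| has the section
   chi^(loc sigma) generating L on U_sigma, and its quotients s/chi^(loc sigma)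
   by the sections s generate the coordinate ring of U_sigma. *)
Definition very_ample (L : line_bundle X) :=
  forall s, maximal_cone X s ->
    H0 L (chi k (L s)) /\
    chart_sections (structure_sheaf X) s `<=`
      subalgebra_gen [set lmul (chi k (- L s)) f | f in H0 L].

Definition ample (L : line_bundle X) :=
  exists2 r : nat, (0 < r)%N & very_ample (tensor_pow L r).

Definition projective := complete_fan X /\ exists A : line_bundle X, ample A.

End Sections.

(* Smooth projective curves over k are given by function fields K/k in one
   variable; their closed points are the normalized discrete valuations of K
   trivial on k, with [v 0] set to 0 so that v is determined by its values on the
   nonzero elements. *)
Section FunctionFields.
Variables (k : closedFieldType) (K : fieldType) (iota : {rmorphism k -> K}).

Definition function_field1 :=
  exists t : K,
    (forall p : {poly k}, p != 0 -> (map_poly iota p).[t] != 0) /\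
    exists b : seq K, forall x : K,
      exists (q : {poly k}) (p : 'I_(size b) -> {poly k}),
        q != 0 /\
        (map_poly iota q).[t] * x =
          \sum_(j < size b) (map_poly iota (p j)).[t] * b`_j.

Definition place : set (K -> int) :=
  [set v | [/\ v 0 = 0,
     forall x y, x != 0 -> y != 0 -> v (x * y) = v x + v y,
     forall x y, x != 0 -> y != 0 -> x + y != 0 ->
       Num.min (v x) (v y) <= v (x + y),
     forall c, c != 0 -> v (iota c) = 0 &
     exists2 x, x != 0 & v x = 1]].

End FunctionFields.

Section Curves.
Variables (R : realType) (k : closedFieldType) (n : nat) (X : fan R n).
Notation M := 'rV[int]_n.

(* A morphism C -> X from a smooth projective curve C, X complete.  The generic
   point of C goes to the orbit O_tau = Spec k[tau^perp /\ M] for one tau in X,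
   by a homomorphism tau^perp /\ M -> K^*, which determines the morphism.
   [centre v] is a cone sigma such that the point v of C goes to U_sigma, i.e.
   such that the coordinate ring k[sigma^vee /\ tau^perp /\ M] of
   U_sigma /\ closure(O_tau) goes to the local ring of C at v. *)
Record curve := Curve {
  curve_field : fieldType;
  curve_iota : {rmorphism k -> curve_field};
  curve_function_field : function_field1 curve_iota;
  orbit_cone : set 'rV[R]_n;
  orbit_cone_fan : X orbit_cone;
  curve_hom : M -> curve_field;
  curve_hom_neq0 : forall m, orth orbit_cone (toR R m) -> curve_hom m != 0;
  curve_homD : forall m m', orth orbit_cone (toR R m) ->
    orth orbit_cone (toR R m') ->
    curve_hom (m + m') = curve_hom m * curve_hom m';
  centre : (curve_field -> int) -> set 'rV[R]_n;
  centre_fan : forall v, place curve_iota v ->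
    X (centre v) /\ orbit_cone `<=` centre v;
  centre_chart : forall v, place curve_iota v -> forall m,
    orth orbit_cone (toR R m) -> dual_cone (centre v) (toR R m) ->
    0 <= v (curve_hom m)
}.

(* The degree of the pullback of L.  On closure(O_tau), L * chi^(-loc tau) is
   the subsheaf of the constant sheaf k(O_tau) generated on U_sigma by
   chi^(loc sigma - loc tau); a line bundle on C generated near v by g_v in K^*
   has degree \sum_v - v(g_v), which is a finite sum. *)
Definition degree (L : line_bundle X) (C : curve) : int :=
  \sum_(v \in place (curve_iota C))
    v (curve_hom C (L (orbit_cone C) - L (@centre C v))).

Definition nef (L : line_bundle X) := forall C : curve, 0 <= degree L C.

End Curves.

Section Edges.
Variables (R : realType) (n : nat).
Implicit Types (P : set 'rV[R]_n) (a b c d u : 'rV[R]_n).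

Definition segment a b : set 'rV[R]_n :=
  [set x | exists2 t : R, 0 <= t <= 1 & x = a + t *: (b - a)].

Definition face P u : set 'rV[R]_n :=
  [set x | P x /\ forall y, P y -> dot x u <= dot y u].

Definition edge P a b := a != b /\ exists u, face P u = segment a b.

Definition no_parallel_edges P :=
  forall a b c d, edge P a b -> edge P c d ->
    segment a b <> segment c d -> ~ exists t : R, b - a = t *: (d - c).

End Edges.

Definition general (R : realType) (k : closedFieldType) (n : nat)
    (X : fan R n) :=
  exists2 A : line_bundle X, ample k A & no_parallel_edges (polytope A).

(* Main.v *)
From HB Require Import structures.
From mathcomp Require Import all_boot all_order all_algebra.
From mathcomp Require Import generic_quotient fraction.
From mathcomp Require Import zify ring lra.
From mathcomp Require Import boolp classical_sets functions cardinality fsbigop.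
From mathcomp Require Import reals.
Require Import Defs.

Set Implicit Arguments.
Unset Strict Implicit.
Unset Printing Implicit Defensive.

Import Order.TTheory GRing.Theory Num.Theory.
Local Open Scope ring_scope.

(** Let S be the semigroup of triples (L1, L2, m) with L1, L2 nef and m a lattice
    point of P_{L1 * L2}; modulo translations it is finitely generated.  A multiple
    N h of each generator h splits as a sum of lattice points of the two polytopes, so
    by Dickson's lemma the set of bad triples (those where m does not split) is a
    finite union of translates of semigroups spanned by sets J of elements N h.  It
    suffices that no such semigroup contains two elements with the same line bundles
    and different lattice points, since then each translate contributes at most one
    bad m for each (L1, L2).

    So let v <> v' be lattice points of P_L with L nef, and let tau be the cone of
    those u at which v and v' are both minimal on P_L.  If tau lies in one cone sigma
    of X then every bundle L2 is linear on tau, with vertex m_sigma; for k large, m +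
    k (v + v') - m_sigma lies in the polytope of L1 + 2k L, so m becomes good after
    adding k (v + v').  If tau lay in no cone of X, then the normal cone of an edge of
    P_L in the face containing v and v' would consist of at least two walls of X, and
    these would give two distinct parallel edges of P_A.

    Nefness is only used on the images of P^1 in closure(O_tau) under one-parameter
    subgroups u in N, for tau the intersection of two cones crossed by a line of
    direction u; it shows that the support function of L is concave. *)

(** * Integer and real pairings, rational cones *)

(** Working over any ring lets integer, rational and real points share one theory; over [R], [dotr]
    and [emb] are [dot] and [toR] up to conversion. *)
Definition dotr (A : comNzRingType) n (m u : 'rV[A]_n) : A :=
  \sum_(j < n) m 0 j * u 0 j.

Definition emb (F : pzRingType) n (m : 'rV[int]_n) : 'rV[F]_n :=
  map_mx (fun z : int => z%:~R) m.

Section Dot.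
Variables (A : comNzRingType) (n : nat).
Implicit Types (m u v : 'rV[A]_n).

Lemma dotrC m u : dotr m u = dotr u m.
Proof. by apply: eq_bigr => j _; rewrite mulrC. Qed.

Lemma dotrDl u v w : dotr (u + v) w = dotr u w + dotr v w :> A.
Proof. by rewrite -big_split; apply: eq_bigr => j _; rewrite mxE mulrDl. Qed.

Lemma dotrZl a u w : dotr (a *: u) w = a * dotr u w.
Proof. by rewrite mulr_sumr; apply: eq_bigr => j _; rewrite mxE mulrA. Qed.

Lemma dotrNl u w : dotr (- u) w = - dotr u w.
Proof. by rewrite -scaleN1r dotrZl mulN1r. Qed.

Lemma dotrBl u v w : dotr (u - v) w = dotr u w - dotr v w :> A.
Proof. by rewrite dotrDl dotrNl. Qed.

Lemma dot0r w : dotr (0 : 'rV[A]_n) w = 0 :> A.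
Proof. by rewrite -(scale0r (0 : 'rV[A]_n)) dotrZl mul0r. Qed.

Lemma dotr_suml (I : Type) (r : seq I) (P : pred I) (f : I -> 'rV[A]_n) w :
  dotr (\sum_(i <- r | P i) f i) w = \sum_(i <- r | P i) dotr (f i) w.
Proof.
apply: (big_ind2 (fun x y => dotr x w = y)) => //; first exact: dot0r.
by move=> x1 x2 y1 y2 <- <-; rewrite dotrDl.
Qed.

Lemma dotrMnl u k w : dotr (u *+ k) w = dotr u w *+ k :> A.
Proof. by elim: k => [|k IH]; rewrite ?mulr0n ?dot0r// !mulrS dotrDl IH. Qed.

Lemma dotrDr u v w : dotr w (u + v) = dotr w u + dotr w v :> A.
Proof. by rewrite !(dotrC w) dotrDl. Qed.

Lemma dotrZr a u w : dotr w (a *: u) = a * dotr w u.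
Proof. by rewrite !(dotrC w) dotrZl. Qed.

Lemma dotrNr u w : dotr w (- u) = - dotr w u.
Proof. by rewrite !(dotrC w) dotrNl. Qed.

Lemma dotrBr u v w : dotr w (u - v) = dotr w u - dotr w v :> A.
Proof. by rewrite dotrDr dotrNr. Qed.

Lemma dotr0 w : dotr w (0 : 'rV[A]_n) = 0 :> A.
Proof. by rewrite dotrC dot0r. Qed.

Lemma dotr_sumr (I : Type) (r : seq I) (P : pred I) (f : I -> 'rV[A]_n) w :
  dotr w (\sum_(i <- r | P i) f i) = \sum_(i <- r | P i) dotr w (f i).
Proof. by rewrite dotrC dotr_suml; apply: eq_bigr => i _; rewrite dotrC. Qed.

Lemma dotr_delta (w : 'rV[A]_n) j : dotr w (delta_mx 0 j) = w 0 j.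
Proof.
rewrite /dotr (bigD1 j)//= big1 ?addr0 ?mxE ?eqxx ?mulr1// => i ij.
by rewrite mxE eqxx (negPf ij) mulr0.
Qed.

End Dot.

Section Emb.
Variables (F : realFieldType) (n : nat).
Implicit Types (m u : 'rV[int]_n).

Lemma dotr_emb m u : dotr (emb F m) (emb F u) = (dotr m u)%:~R.
Proof.
by rewrite rmorph_sum; apply: eq_bigr => j _; rewrite !mxE rmorphM.
Qed.

Lemma embD m u : emb F (m + u) = emb F m + emb F u.
Proof. by apply/matrixP => i j; rewrite !mxE rmorphD. Qed.

Lemma embN m : emb F (- m) = - emb F m.
Proof. by apply/matrixP => i j; rewrite !mxE rmorphN. Qed.

Lemma embB m u : emb F (m - u) = emb F m - emb F u.
Proof. by rewrite embD embN. Qed.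

Lemma emb0 : emb F 0 = 0 :> 'rV_n.
Proof. by apply/matrixP => i j; rewrite !mxE. Qed.

Lemma embZ (a : int) m : emb F (a *: m) = a%:~R *: emb F m.
Proof. by apply/matrixP => i j; rewrite !mxE rmorphM. Qed.

Lemma embMn m k : emb F (m *+ k) = emb F m *+ k.
Proof. by elim: k => [|k IH]; rewrite ?emb0// !mulrS embD IH. Qed.

Lemma emb_sum (I : Type) (r : seq I) (P : pred I) (f : I -> 'rV[int]_n) :
  emb F (\sum_(i <- r | P i) f i) = \sum_(i <- r | P i) emb F (f i).
Proof. by apply: (big_morph _ embD emb0). Qed.

Lemma emb_inj : injective (@emb F n).
Proof.
move=> m u /matrixP e; apply/matrixP => i j; have := e i j.
by rewrite !mxE => /eqP; rewrite eqr_int => /eqP.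
Qed.

End Emb.

(** Over [R] this is [cone_gen]; the field varies so that rational and real points of one cone can
    be compared. *)
Definition hull (F : realFieldType) n (g : seq 'rV[int]_n) (u : 'rV[F]_n) :=
  exists c : 'I_(size g) -> F,
     (forall i, 0 <= c i) /\ u = \sum_(i < size g) c i *: emb F g`_i.

Section Hull.
Variables (F : realFieldType) (n : nat).
Implicit Types (g : seq 'rV[int]_n) (m u : 'rV[F]_n).

Lemma hull_nil u : hull [::] u <-> u = 0.
Proof.
split=> [[c [_ ->]]|->]; first by rewrite big_ord0.
by exists (fun=> 0); rewrite big_ord0.
Qed.

Lemma hull_cons x g u :
  hull (x :: g) u <-> exists2 c, 0 <= c & hull g (u - c *: emb F x).
Proof.
split=> [[c [c0 ->]]|[c c0 [d [d0 e]]]].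
  exists (c ord0) => //; exists (fun i => c (lift ord0 i)); split=> //.
  by rewrite big_ord_recl /= addrC addKr.
exists (fun i => oapp d c (unlift ord0 i)); split=> [i|].
  by case: unliftP => [j|] _ /=.
rewrite big_ord_recl /= unlift_none /=; apply/eqP.
rewrite addrC -subr_eq e; apply/eqP/eq_bigr => i _; by rewrite liftK.
Qed.

Lemma hull_mem g x : x \in g -> hull g (emb F x).
Proof.
move=> xg; have ix : (index x g < size g)%N by rewrite index_mem.
exists (fun i => (i == Ordinal ix)%:R); split=> [i|]; first exact: ler0n.
rewrite (bigD1 (Ordinal ix))//= eqxx scale1r nth_index// big1 ?addr0// => i /negPf->.
by rewrite scale0r.
Qed.

Lemma hullD g u v : hull g u -> hull g v -> hull g (u + v).
Proof.
move=> [c [c0 ->]] [d [d0 ->]]; exists (fun i => c i + d i).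
split=> [i|]; first exact: addr_ge0.
by rewrite -big_split; apply: eq_bigr => i _; rewrite scalerDl.
Qed.

Lemma hull0 g : hull g (0 : 'rV[F]_n).
Proof.
by exists (fun=> 0); split=> //; rewrite big1// => i _; rewrite scale0r.
Qed.

Lemma hullZ g a u : 0 <= a -> hull g u -> hull g (a *: u).
Proof.
move=> a0 [c [c0 ->]]; exists (fun i => a * c i); split=> [i|]; first exact: mulr_ge0.
by rewrite scaler_sumr; apply: eq_bigr => i _; rewrite scalerA.
Qed.

Lemma hull_sum g (I : Type) (r : seq I) (P : pred I) (f : I -> 'rV[F]_n) :
  (forall i, P i -> hull g (f i)) -> hull g (\sum_(i <- r | P i) f i).
Proof.
move=> h; elim/big_rec: _ => [|i x Pi hx]; first exact: hull0.
by apply: hullD => //; apply: h.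
Qed.

Lemma hull_ge0 g m u :
  (forall x, x \in g -> 0 <= dotr m (emb F x)) -> hull g u -> 0 <= dotr m u.
Proof.
move=> mg [c [c0 ->]]; rewrite dotr_sumr sumr_ge0// => i _.
by rewrite dotrZr mulr_ge0// mg// mem_nth.
Qed.

Lemma hull_eq0 g m u :
  (forall x, x \in g -> dotr m (emb F x) = 0) -> hull g u -> dotr m u = 0.
Proof.
move=> mg [c [c0 ->]]; rewrite dotr_sumr big1// => i _.
by rewrite dotrZr mg ?mulr0// mem_nth.
Qed.

End Hull.

Lemma list_max (F : realDomainType) (s : seq F) (x0 : F) :
  exists2 c, c \in x0 :: s & {in x0 :: s, forall x, x <= c}.
Proof.
elim: s x0 => [|y s IH] x0; first by exists x0; rewrite ?inE// => x /[1!inE]/eqP->.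
have [c cs cm] := IH y; have [xc|cx] := leP x0 c.
  exists c; first by rewrite inE cs orbT.
  by move=> x /[1!inE]/predU1P[->//|/cm].
exists x0; first by rewrite inE eqxx.
by move=> x /[1!inE]/predU1P[->//|/cm/le_trans]; apply; apply: ltW.
Qed.

(* Fourier-Motzkin elimination of the coefficient of each generator in turn. *)
Theorem weyl n (g : seq 'rV[int]_n) : exists ms : seq 'rV[int]_n,
  forall (F : realFieldType) (u : 'rV[F]_n),
    hull g u <-> forall m, m \in ms -> 0 <= dotr (emb F m) u.
Proof.
elim: g => [|x g [ms IH]].
  (* The zero cone is cut out by the coordinates and their negatives. *)
  exists ([seq delta_mx 0 j | j <- enum 'I_n] ++ [seq - delta_mx 0 j | j <- enum 'I_n]).
  move=> F u; rewrite hull_nil; have e j : emb F (delta_mx 0 j) = delta_mx 0 j.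
    by apply/matrixP => i k; rewrite !mxE; case: (_ && _).
  split=> [-> m _|h]; first by rewrite dotr0.
  apply/matrixP => i j; rewrite mxE (ord1 i); apply/eqP.
  rewrite eq_le -[u 0 j]dotr_delta dotrC -oppr_ge0 -dotrNl -{1 2}e -embN !h//.
    by rewrite mem_cat map_f ?mem_enum.
  by rewrite mem_cat (map_f (fun j => - delta_mx 0 j)) ?mem_enum ?orbT.
(* A coefficient c >= 0 of [x] has to satisfy c <m,x> <= <m,u> for all m in [ms]. [P] compares the
   upper bounds on c with 0 and keeps the forms vanishing at [x]; [Q] compares each upper bound with
   each lower bound. *)
pose P := [seq m <- ms | 0 <= dotr m x].
pose Q := [seq dotr a x *: b - dotr b x *: a |
             a <- [seq a <- ms | 0 < dotr a x], b <- [seq b <- ms | dotr b x < 0]].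
exists (P ++ Q) => F u; rewrite hull_cons; split.
  move=> [c c0 /IH h] m; rewrite mem_cat => /orP[|].
    rewrite mem_filter => /andP[mx /h]; rewrite dotrBr dotrZr dotr_emb subr_ge0.
    by apply: le_trans; rewrite mulr_ge0// ler0z.
  case/allpairsP => -[a b] /=[]; rewrite !mem_filter => /andP[ax /h ha] /andP[bx /h hb] ->.
  move: ha hb; rewrite embB !embZ dotrBl !dotrBr !dotrZr !dotr_emb !dotrZl.
  have ax' : 0 < (dotr a x)%:~R :> F by rewrite ltr0z.
  have bx' : (dotr b x)%:~R < 0 :> F by rewrite ltrz0.
  move: ((dotr a x)%:~R : F) ((dotr b x)%:~R : F) ax' bx' => p q p0 q0.
  move: (dotr _ u) (dotr _ u) => A B h1 h2; nra.
move=> h.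
(* The largest lower bound, 0 included, serves as c. *)
pose lo := [seq dotr (emb F b) u / (dotr b x)%:~R | b <- [seq b <- ms | dotr b x < 0]].
have [c cl cm] := list_max lo 0.
exists c; first by apply: cm; rewrite inE eqxx.
apply/IH => m mms; rewrite dotrBr dotrZr dotr_emb subr_ge0.
have [mx|mx|mx] := ltgtP (dotr m x) 0.
- have mx' : (dotr m x)%:~R < 0 :> F by rewrite ltrz0.
  rewrite -ler_ndivrMr//; apply: cm; rewrite inE; apply/orP; right.
  by apply: (map_f (fun b => dotr (emb F b) u / (dotr b x)%:~R)); rewrite mem_filter mx.
- have mx' : 0 < (dotr m x)%:~R :> F by rewrite ltr0z.
  move: cl; rewrite inE => /predU1P[->|/mapP[b]].
    by rewrite mul0r h// mem_cat mem_filter mms ltW.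
  rewrite mem_filter => /andP[bx bms] ->.
  have bx' : (dotr b x)%:~R < 0 :> F by rewrite ltrz0.
  have : 0 <= dotr (emb F (dotr m x *: b - dotr b x *: m)) u.
    apply: h; rewrite mem_cat; apply/orP; right; apply/allpairsP.
    by exists (m, b); split=> //=; rewrite mem_filter ?mx ?bx.
  rewrite embB !embZ dotrBl !dotrZl mulrAC ler_ndivrMr//.
  by rewrite subr_ge0 mulrC [(dotr m x)%:~R * _]mulrC.
by rewrite mx mulr0 h// mem_cat mem_filter mms mx lexx.
Qed.

(** This supplies the small perturbations used below. A pair (a, b) with a > 0 allows every d up to
    a / (|b| + 1), where the 1 guards against b = 0. *)
Lemma small (F : realFieldType) (s : seq (F * F)) :
  exists2 e : F, 0 < e & forall d, 0 <= d <= e ->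
    forall p, p \in s -> 0 < p.1 -> 0 < p.1 + d * p.2.
Proof.
elim: s => [|[a b] s [e e0 h]]; first by exists 1.
have [a0|a0] := ltP 0 a; last first.
  exists e => // d /h hd p; rewrite inE => /predU1P[->/=|/hd//].
  by rewrite ltNge a0.
pose f := a / (`|b| + 1).
have b1 : 0 < `|b| + 1 by rewrite ltr_wpDl.
exists (Num.min e f); first by rewrite lt_min e0 divr_gt0.
move=> d /andP[d0]; rewrite le_min => /andP[de df] p; rewrite inE => /predU1P[->/= _|ps].
  have : d * (`|b| + 1) <= a by rewrite -ler_pdivlMr.
  have := ler_norm (- b); rewrite normrN; move: `|b| => B; move: d0.
  rewrite le_eqVlt => /predU1P[<-|d0]; first by rewrite !mul0r addr0.
  by nra.
by apply: h => //; rewrite d0.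
Qed.

Lemma dotr_ge0 (F : realFieldType) n (w : 'rV[F]_n) : 0 <= dotr w w.
Proof. by rewrite sumr_ge0// => j _; rewrite -expr2 sqr_ge0. Qed.

Lemma dotr_eq0 (F : realFieldType) n (w : 'rV[F]_n) : (dotr w w == 0) = (w == 0).
Proof.
apply/idP/eqP => [|->]; last by rewrite dot0r.
rewrite /dotr psumr_eq0 => [/allP h|j _]; last by rewrite -expr2 sqr_ge0.
apply/matrixP => p j; rewrite (ord1 p) mxE; apply/eqP.
by have := h j (mem_index_enum _); rewrite /= mulf_eq0 orbb.
Qed.

(** If [x] is orthogonal to the new vector [d], adding a small multiple of [d] makes that pairing
    positive and keeps the other nonzero pairings nonzero. *)
Lemma generic (F : realFieldType) n (s : seq 'rV[F]_n) :
  exists x : 'rV[F]_n, forall d, d \in s -> d != 0 -> dotr d x != 0.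
Proof.
elim: s => [|d s [x hx]]; first by exists 0.
have [dx|dx] := eqVneq (dotr d x) 0; last first.
  by exists x => e; rewrite inE => /predU1P[->|/hx].
have [->|d0] := eqVneq d 0.
  by exists x => e; rewrite inE => /predU1P[->|/hx//]; rewrite eqxx.
(* Since [small] preserves positivity only, each pairing is listed with both signs. *)
have [e e0 he] := small ([seq (dotr v x, dotr v d) | v <- s] ++
                          [seq (- dotr v x, - dotr v d) | v <- s]).
exists (x + e *: d) => v; rewrite inE => /predU1P[-> _|vs v0].
  by rewrite dotrDr dx add0r dotrZr mulf_neq0 ?(gt_eqF e0)// dotr_eq0.
rewrite dotrDr dotrZr; have := hx v vs v0; case: ltgtP => // vx _.
  rewrite lt_eqF//; rewrite -oppr_gt0 opprD -mulrN.
  apply: (he _ _ (- dotr v x, - dotr v d)); rewrite ?lexx ?ltW ?oppr_gt0//.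
  by rewrite mem_cat (map_f (fun v => (- dotr v x, - dotr v d))) ?orbT.
rewrite gt_eqF//; apply: (he _ _ (dotr v x, dotr v d)); rewrite ?lexx ?ltW//.
by rewrite mem_cat (map_f (fun v => (dotr v x, dotr v d))).
Qed.

(** * Dickson's and Gordan's lemmas *)

Definition cap (T : Type) (K : nat) (z : T -> nat) : T -> nat := fun i => minn (z i) K.

(** Induction on q. Each fixed last coordinate c has a bound [Kc c], and forgetting the last
    coordinate gives a bound [K]. Each of the finitely many vectors truncated at [K] needs only one
    admissible last coordinate, so a last coordinate of at least [C] can be lowered; the values
    below [C] are covered by finitely many [Kc c]. *)
Lemma dickson_nat q (U : (nat -> nat) -> Prop) :
  (forall z z', (forall i, (i < q)%N -> (z i <= z' i)%N) -> U z -> U z') ->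
  exists K, forall z, U z -> U (cap K z).
Proof.
elim: q U => [|q IH] U mono; first by exists 0%N => z; apply: mono.
pose ext (z : nat -> nat) c i := if (i < q)%N then z i else c.
have IHc c : exists K, forall z, U (ext z c) -> U (ext (cap K z) c).
  apply: (IH (fun z => U (ext z c))) => z z' zz'; apply: mono => i _.
  by rewrite /ext; case: ifP => // /zz'.
have [Kc hKc] := choice IHc.
have [K hK] : exists K, forall z, (exists c, U (ext z c)) -> exists c, U (ext (cap K z) c).
  apply: (IH (fun z => exists c, U (ext z c))) => z z' zz' [c h]; exists c; move: h.
  by apply: mono => i _; rewrite /ext; case: ifP => // /zz'.
pose val_of (t : {ffun 'I_q -> 'I_K.+1}) i := oapp (fun j => t j : nat) 0%N (insub i).
have [ct hct] : exists ct : {ffun 'I_q -> 'I_K.+1} -> nat, forall t,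
    (exists c, U (ext (val_of t) c)) -> U (ext (val_of t) (ct t)).
  suff /choice[ct] : forall t, exists c,
    (exists c, U (ext (val_of t) c)) -> U (ext (val_of t) c) by exists ct.
  move=> t; have [[c h]|h] := pselect (exists c, U (ext (val_of t) c)); first by exists c.
  by exists 0%N.
pose C := \max_t ct t.
exists (maxn (maxn K C) (\max_(c < C) Kc c)) => z Uz.
have Ue : U (ext z (z q)).
  by apply: mono Uz => i; rewrite /ext ltnS leq_eqVlt => /predU1P[->|->//]; rewrite ltnn.
have [zC|Cz] := ltnP (z q) C.
  apply: mono (hKc _ _ Ue) => i iq; rewrite /ext /cap.
  have := leq_bigmax (F := fun c : 'I_C => Kc c) (Ordinal zC) => /= hb.
  by move: iq; rewrite ltnS leq_eqVlt => /predU1P[->|->]; rewrite ?ltnn; lia.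
have [|c] := hK z; first by exists (z q).
pose t : {ffun 'I_q -> 'I_K.+1} := [ffun i : 'I_q => inord (cap K z i)].
have tE i : (i < q)%N -> val_of t i = cap K z i.
  move=> iq; rewrite /val_of insubT/= ffunE inordK// ltnS /cap; exact: geq_minr.
move=> hc; have /hct ht : exists c, U (ext (val_of t) c).
  by exists c; apply: mono hc => i _; rewrite /ext; case: ifP => // /tE->.
apply: mono ht => i; rewrite ltnS leq_eqVlt /ext => /predU1P[->|iq].
  rewrite ltnn /cap; have := leq_bigmax (F := ct) t; rewrite -/C; lia.
by rewrite iq tE// /cap; lia.
Qed.

(* [K] bounds the coordinates of the minimal elements of [U]. *)
Lemma dickson (T : finType) (U : (T -> nat) -> Prop) :
  (forall z z', (forall i, (z i <= z' i)%N) -> U z -> U z') ->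
  exists K, forall z, U z -> U (cap K z).
Proof.
move=> mono.
have [K hK] := @dickson_nat #|T| (fun y => U (fun t => y (enum_rank t)))
  (fun z z' zz' => mono _ _ (fun i => zz' _ (ltn_ord _))).
exists K => z Uz.
pose y i := oapp (fun j => z (enum_val j)) 0%N (insub i : option 'I_#|T|).
have yE t : y (enum_rank t) = z t by rewrite /y insubT ?ltn_ord//= => p; rewrite (_ : Sub _ _ = enum_rank t) ?enum_rankK//; apply/val_inj.
have e : (fun t => y (enum_rank t)) = z by apply/funext.
by have := hK y; rewrite /cap e; under eq_fun do rewrite yE; apply.
Qed.

(* The values of [fs] embed the monoid in N^q; its minimal nonzero elements there,
   finitely many by Dickson's lemma, generate it. *)
Lemma gordan (V : zmodType) (P : V -> Prop) (fs : seq (V -> int)) :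
  P 0 -> (forall x y, P x -> P y -> P (x - y)) ->
  (forall f, f \in fs -> forall x y, f (x - y) = f x - f y) ->
  (forall x, P x -> (forall f, f \in fs -> f x = 0) -> x = 0) ->
  exists (T : finType) (h : T -> V),
    (forall t, P (h t) /\ forall f, f \in fs -> 0 <= f (h t)) /\
    forall x, P x -> (forall f, f \in fs -> 0 <= f x) ->
      exists z : T -> nat, x = \sum_t h t *+ z t.
Proof.
move=> P0 PB fB inj.
pose S x := P x /\ forall f, f \in fs -> 0 <= f x.
have S0 : S 0 by split=> // f /fB /(_ 0 0); rewrite subrr => ->; rewrite subrr.
pose q := size fs; pose F k := nth (fun=> 0) fs k.
have Fin k : (k < q)%N -> F k \in fs by apply: mem_nth.
(* [W] is upward closed in z. Truncating the values of a nonzero x at [K] thus leaves room for a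
   nonzero element with values at most those of x. One such element per truncated vector is chosen
   as a generator, and it is subtracted from x. *)
pose W (x : V) (z : nat -> nat) := [/\ S x, x != 0 & forall k, (k < q)%N -> (`|F k x| <= z k)%N].
have [K hK] : exists K, forall z, (exists x, W x z) -> exists x, W x (cap K z).
  apply: (@dickson_nat q (fun z => exists x, W x z)) => z z' zz' [x [Sx x0 hx]].
  by exists x; split=> // k kq; apply: leq_trans (hx k kq) (zz' k kq).
pose T : finType := {ffun 'I_q -> 'I_K.+1}.
pose vt (t : T) i := oapp (fun j => t j : nat) 0%N (insub i).
have [h hh] : exists h : T -> V, forall t, S (h t) /\ ((exists x, W x (vt t)) -> W (h t) (vt t)).
  suff /choice[h] : forall t, exists y, S y /\ ((exists x, W x (vt t)) -> W y (vt t)).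
    by exists h.
  move=> t.
  have [[x hx]|hx] := pselect (exists x, W x (vt t)); last by exists 0.
  by exists x; split=> //; case: hx.
exists T, h; split=> [t|x Px fx]; first by case: (hh t).
have Sx : S x by [].
have [N] := ubnP (\sum_(k < q) `|F k x|)%N.
elim: N x Sx {Px fx} => // N IH x [Px fx] lN.
have [->|x0] := eqVneq x 0.
  by exists (fun=> 0%N); rewrite big1// => t _; rewrite mulr0n.
have [|y [[Py fy] y0 hy]] := hK (fun k => `|F k x|%N); first by exists x; split.
pose t : T := [ffun i : 'I_q => inord (cap K (fun k => `|F k x|%N) i)].
have tE i : (i < q)%N -> vt t i = cap K (fun k => `|F k x|%N) i.
  move=> iq; rewrite /vt insubT/= ffunE inordK// ltnS /cap; exact: geq_minr.
have [_ [|[Pt ft] t0 ht]] := hh t.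
  by exists y; split=> // k kq; rewrite tE//; apply: hy.
have le k : (k < q)%N -> F k (h t) <= F k x.
  move=> kq; have := ht k kq; rewrite tE// /cap; have := ft _ (Fin _ kq); have := fx _ (Fin _ kq).
  lia.
have [||z e] := IH (x - h t).
- split; first exact: PB.
  by move=> f ff; rewrite fB// subr_ge0; have := nth_index (fun=> 0) ff; rewrite -/(F _) => <-; apply: le; rewrite index_mem.
- rewrite ltnS in lN; apply: leq_trans lN.
  have [k kt] : exists k : 'I_q, F k (h t) != 0.
    apply: contra_notP (negP t0) => hn; apply/eqP/inj => // f ff.
    have iq : (index f fs < q)%N by rewrite index_mem.
    apply: contra_notP hn => /eqP fn; exists (Ordinal iq); by rewrite /= /F nth_index.
  rewrite (bigD1 k)//= [ltnRHS](bigD1 k)//= -addSn leq_add//.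
    rewrite fB ?Fin//; have := le k (ltn_ord _); have := ft _ (Fin _ (ltn_ord k)).
    by move: kt; lia.
  apply: leq_sum => j _; rewrite fB ?Fin//; have := le j (ltn_ord _).
  by have := ft _ (Fin _ (ltn_ord j)); lia.
exists (fun s => z s + (s == t))%N.
under eq_bigr do rewrite mulrnDr; rewrite big_split/= -e (bigD1 t)//= eqxx big1 ?addr0 ?subrK//.
by move=> s /negPf->.
Qed.

(** * Cartier data and their polytopes *)

Lemma dotr_row_mx (A : comNzRingType) n1 n2 (a c : 'rV[A]_n1) (b d : 'rV[A]_n2) :
  dotr (row_mx a b) (row_mx c d) = dotr a c + dotr b d.
Proof.
rewrite /dotr big_split_ord /=; congr (_ + _).
  by apply: eq_bigr => i _; rewrite !row_mxEl.
by apply: eq_bigr => i _; rewrite !row_mxEr.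
Qed.

Lemma hull_family (F : realFieldType) n r (f : 'I_r -> 'rV[int]_n) (u : 'rV[F]_n) :
  hull [seq f i | i <- enum 'I_r] u ->
  exists2 c : 'I_r -> F, (forall i, 0 <= c i) & u = \sum_i c i *: emb F (f i).
Proof.
set g := map _ _ => -[c [c0 ->]].
have sg : r = size g by rewrite size_map size_enum_ord.
exists (fun i => c (cast_ord sg i)) => [i|]; first exact: c0.
rewrite (reindex (cast_ord sg)) /=; last first.
  by exists (cast_ord (esym sg)) => i _; rewrite ?cast_ordK ?cast_ordKV.
apply: eq_bigr => i _; congr (_ *: emb F _).
by rewrite (nth_map i) ?size_enum_ord// nth_ord_enum.
Qed.

(** The inequalities of [weyl] are the same over all fields, and at an integer point they are
    inequalities between integers. *)
Lemma hull_emb (F F' : realFieldType) n (g : seq 'rV[int]_n) (w : 'rV[int]_n) :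
  hull g (emb F w) -> hull g (emb F' w).
Proof.
have [ms h] := weyl g => /h hw; apply/h => m /hw.
by rewrite !dotr_emb !ler0z.
Qed.

Lemma common_denominator r (c : 'I_r -> rat) : (forall i, 0 <= c i) ->
  exists2 N : nat, (0 < N)%N & exists k : 'I_r -> nat, forall i, N%:R * c i = (k i)%:R.
Proof.
move=> c0; exists (\prod_i `|denq (c i)|)%N.
  by rewrite prodn_gt0// => i; rewrite absz_gt0 denq_neq0.
exists (fun i => `|numq (c i)| * \prod_(j | j != i) `|denq (c j)|)%N => i.
rewrite (bigD1 i)//= !natrM mulrAC; congr (_ * _).
have dE : (`|denq (c i)|%N)%:R = (denq (c i))%:~R :> rat.
  by rewrite -[in RHS](gez0_abs (ltW (denq_gt0 _))).
have nE : (`|numq (c i)|%N)%:R = (numq (c i))%:~R :> rat.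
  by rewrite -[in RHS](@gez0_abs (numq (c i))) ?numq_ge0.
by rewrite dE nE mulrC -[X in X * _]divq_num_den divfK// intr_eq0 denq_neq0.
Qed.

(** The nonnegative numbers c_i (<L_i,u> - <v,u>) add up to zero. *)
Lemma conv_face (F : realFieldType) n r (L : 'I_r -> 'rV[F]_n) (c : 'I_r -> F) (v u : 'rV[F]_n) :
  (forall i, 0 <= c i) -> \sum_i c i = 1 -> v = \sum_i c i *: L i ->
  (forall i, dotr v u <= dotr (L i) u) -> forall i, c i != 0 -> dotr (L i) u = dotr v u.
Proof.
move=> c0 c1 vE le i ci.
have /eqP : \sum_i c i * (dotr (L i) u - dotr v u) = 0.
  rewrite (eq_bigr (fun i => dotr (c i *: L i) u - c i * dotr v u)) => [|j _].
    by rewrite sumrB -dotr_suml -vE -mulr_suml c1 mul1r subrr.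
  by rewrite dotrZl mulrBr.
rewrite psumr_eq0 => [|j _]; last by rewrite mulr_ge0// subr_ge0.
move=> /allP /(_ i (mem_index_enum _)); rewrite /= mulf_eq0 (negPf ci) subr_eq0.
by move/eqP.
Qed.

(* A simplex pivot: [L p], [L q] are adjacent in the face of the [L i], i in P. *)
Lemma pivot (F : realFieldType) n r (L : 'I_r -> 'rV[F]_n) (P : pred 'I_r)
    (D : seq 'rV[F]_n) i1 i2 :
  (forall i j, L i - L j \in D) -> P i1 -> P i2 -> L i1 != L i2 ->
  exists p q z, [/\ P p, P q, L q != L p,
    dotr (L q - L p) z = 0 /\ (forall i, P i -> 0 <= dotr (L i - L p) z) &
    forall d, d \in D -> dotr d z = 0 -> exists s, d = s *: (L q - L p)].
Proof.
move=> LD P1 P2 L12.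
have [x hx] := generic D.
(* With this choice of [y], two differences d and w with the same slope <d,y> / <d,x> = <w,y> /
   <w,x> are parallel. *)
have [y hy] := generic [seq dotr w x *: d - dotr d x *: w | d <- D, w <- D].
case: (@Order.TotalTheory.arg_minP _ _ _ i1 P (fun i => dotr (L i) x) P1) => p Pp hp.
have [q0 /andP[Pq0 Lq0]] : exists q, P q && (L q != L p).
  have [e|] := eqVneq (L i1) (L p); last by exists i1; rewrite P1.
  by exists i2; rewrite P2 -e eq_sym.
have gt0 i : P i -> L i != L p -> 0 < dotr (L i - L p) x.
  move=> Pi Li; rewrite lt_neqAle dotrBl subr_ge0 (hp i Pi) andbT eq_sym -dotrBl.
  by apply: hx => //; rewrite subr_eq0.
have C0 : P q0 && (L q0 != L p) by rewrite Pq0.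
case: (@Order.TotalTheory.arg_minP _ _ _ q0 (fun q => P q && (L q != L p))
  (fun i => dotr (L i - L p) y / dotr (L i - L p) x) C0) => q /andP[Pq Lq] hq.
set w := L q - L p in hq *.
(* Among the points of P other than L_p, q minimises the slope of L_i - L_p, with minimum [la]. So z
   = y - la x is zero on [w] and nonnegative on all the L_i - L_p. *)
pose la := dotr w y / dotr w x.
have wx : 0 < dotr w x by apply: gt0.
exists p, q, (y - la *: x); split=> //.
  split=> [|i Pi]; rewrite dotrBr dotrZr; first by rewrite /la divfK ?subrr ?gt_eqF.
  have [->|Li] := eqVneq (L i) (L p); first by rewrite subrr !dot0r mulr0 subr0.
  by rewrite subr_ge0 -ler_pdivlMr ?gt0//; apply: hq; rewrite Pi.
move=> d dD; rewrite dotrBr dotrZr => /eqP; rewrite subr_eq0 => /eqP e.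
exists (dotr d x / dotr w x); apply/eqP; rewrite mulrC -scalerA.
rewrite -[X in X == _]scale1r -(mulVf (lt0r_neq0 wx)) -scalerA -subr_eq0 -scalerBr scaler_eq0.
rewrite invr_eq0 gt_eqF//=; apply/negPn/negP => n0.
have /hy /(_ n0) : dotr w x *: d - dotr d x *: w \in [seq dotr w x *: d - dotr d x *: w | d <- D, w <- D].
  by apply/allpairsP; exists (d, w); split => //; apply: LD.
by rewrite dotrBl !dotrZl e mulrA [dotr w x * _]mulrC /la divfK ?(gt_eqF wx)// mulrC subrr eqxx.
Qed.

Section Polytopes.
Variables (R : realType) (n r : nat) (G : 'I_r -> seq 'rV[int]_n).
Hypothesis complete : forall u : 'rV[R]_n, exists i, hull (G i) u.

Notation D := {ffun 'I_r -> 'rV[int]_n}.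
Implicit Types (l : D) (m v : 'rV[int]_n).

(* [l i] is the Cartier datum on the i-th full-dimensional cone, which has
   generators [G i]; [inP l] and [inPF l] are the integer and F-rational points
   of the polytope of [l]. *)
Definition nefd l := forall i j u, u \in G i -> dotr (l i) u <= dotr (l j) u.

Definition inP l m := forall i u, u \in G i -> dotr (l i) u <= dotr m u.

Definition inPF (F : realFieldType) l (x : 'rV[F]_n) :=
  forall i u, u \in G i -> dotr (emb F (l i)) (emb F u) <= dotr x (emb F u).

Lemma inP_emb (F : realFieldType) l m : inP l m <-> inPF l (emb F m).
Proof.
by split=> h i u /h; rewrite !dotr_emb ler_int.
Qed.

Lemma inPF_hull (F : realFieldType) l (x u : 'rV[F]_n) i : inPF l x -> hull (G i) u ->
  dotr (emb F (l i)) u <= dotr x u.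
Proof.
move=> lx hu; rewrite -subr_ge0 -dotrBl; apply: hull_ge0 hu => g /lx.
by rewrite -subr_ge0 dotrBl.
Qed.

Lemma nefd_inP l : nefd l <-> forall i, inP l (l i).
Proof. by split=> h i j u ?; apply: h. Qed.

Lemma inPD l1 l2 m1 m2 : inP l1 m1 -> inP l2 m2 -> inP (l1 + l2) (m1 + m2).
Proof.
by move=> h1 h2 i u iu; rewrite ffunE !dotrDl lerD ?h1 ?h2.
Qed.

Lemma inP0 : inP 0 0.
Proof. by move=> i u _; rewrite ffunE. Qed.

Lemma inP_sum (T : Type) (s : seq T) (l : T -> D) (m : T -> 'rV[int]_n) :
  (forall t, inP (l t) (m t)) -> inP (\sum_(t <- s) l t) (\sum_(t <- s) m t).
Proof.
move=> h; elim: s => [|t s IH]; first by rewrite !big_nil; apply: inP0.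
by rewrite !big_cons; apply: inPD.
Qed.

Lemma inPMn l m k : inP l m -> inP (l *+ k) (m *+ k).
Proof.
by move=> h; elim: k => [|k IH]; [exact: inP0|rewrite !mulrS; apply: inPD].
Qed.

Lemma nefdD l1 l2 : nefd l1 -> nefd l2 -> nefd (l1 + l2).
Proof.
by move=> /nefd_inP h1 /nefd_inP h2; apply/nefd_inP => i; rewrite ffunE; apply: inPD.
Qed.

(** Points are lifted to height 1 and [weyl] is applied to the cone over the l_i. If a + <w,.> is
    nonnegative at all l_i, then w lies in some cone i of the fan, where <w,l_i> <= <w,x>; so it is
    nonnegative at [x]. *)
Lemma conv (F : realFieldType) l (x : 'rV[F]_n) : inPF l x ->
  exists c : 'I_r -> F, [/\ forall i, 0 <= c i, \sum_i c i = 1 &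
    x = \sum_i c i *: emb F (l i)].
Proof.
move=> lx; pose f i := row_mx (const_mx 1 : 'rV_1) (l i).
suff : hull [seq f i | i <- enum 'I_r] (row_mx (const_mx 1 : 'rV_1) x).
  case/hull_family => c c0 e; exists c; split=> //.
    move/matrixP/(_ 0 (lshift _ 0)): e; rewrite row_mxEl mxE summxE => ->.
    by apply: eq_bigr => i _; rewrite mxE mxE row_mxEl mxE mulr1.
  apply/matrixP => a j; move/matrixP/(_ a (rshift _ j)): e; rewrite row_mxEr => ->.
  by rewrite !summxE; apply: eq_bigr => i _; rewrite mxE mxE row_mxEr !mxE.
have [ms h] := weyl [seq f i | i <- enum 'I_r]; apply/h => mu mum.
have hi i : 0 <= dotr (emb F mu) (emb F (f i)).
  by have /h := hull_mem F (map_f f (mem_enum 'I_r i)); apply.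
rewrite -[mu](@hsubmxK _ 1 1 n); set a := lsubmx _; set w := rsubmx _.
(* Completeness is known over [R]; as w is integral, [hull_emb] carries it to [F]. *)
have [i hw] := complete (emb R w); have {}hw := hull_emb F hw.
have := hi i; rewrite -[mu](@hsubmxK _ 1 1 n) -/a -/w /f /emb !map_row_mx !dotr_row_mx.
rewrite map_const_mx => /le_trans; apply; apply: lerD => //.
by rewrite dotrC [leRHS]dotrC; apply: inPF_hull hw.
Qed.

(** Over the rationals m is a convex combination of the points l1_i + l2_i. Clearing denominators
    makes the weights natural numbers k_i with sum N, and the two summands are then separated. *)
Lemma split_multiple l1 l2 m : nefd l1 -> nefd l2 -> inP (l1 + l2) m ->
  exists2 N : nat, (0 < N)%N & exists a b,
    [/\ inP (l1 *+ N) a, inP (l2 *+ N) b & m *+ N = a + b].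
Proof.
move=> /nefd_inP h1 /nefd_inP h2 /(@inP_emb rat)/conv [c [c0 c1 mE]].
have [N N0 [k hk]] := common_denominator c0.
have Nk : N = (\sum_i k i)%N.
  apply/eqP; rewrite -(eqr_nat rat) natr_sum -(eq_bigr _ (fun i _ => hk i)).
  by rewrite -mulr_sumr c1 mulr1.
have hl (l : D) : (forall i, inP l (l i)) -> inP (l *+ N) (\sum_i l i *+ k i).
  move=> h; rewrite Nk -sumrMnr; apply: inP_sum => i; exact: inPMn.
exists N => //; exists (\sum_i l1 i *+ k i), (\sum_i l2 i *+ k i).
split; [exact: hl|exact: hl|].
apply: (@emb_inj rat); rewrite embMn mE -scaler_nat scaler_sumr -big_split emb_sum.
apply: eq_bigr => i _; rewrite scalerA hk scaler_nat -embMn; congr emb.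
by rewrite ffunE mulrnDl.
Qed.

End Polytopes.

Lemma dotE (R : realType) n (m u : 'rV[R]_n) : dot m u = dotr m u.
Proof. by []. Qed.

(** * Normal cones of edges of the ample polytope *)

Section SingleCone.
Variables (R : realType) (n r : nat) (G : 'I_r -> seq 'rV[int]_n).
Hypothesis complete : forall u : 'rV[R]_n, exists i, hull (G i) u.

Notation D := {ffun 'I_r -> 'rV[int]_n}.
Implicit Types (l : D) (m v : 'rV[int]_n).

Variable a : D.
Hypothesis nefa : nefd G a.
Hypothesis stricta : forall i (u : 'rV[R]_n),
  (forall j, dotr (emb R (a i)) u <= dotr (emb R (a j)) u) -> hull (G i) u.

Local Notation A i := (emb R (a i)).
Local Notation PA := [set x : 'rV[R]_n | inPF G a x]%classic.
Local Notation minA u i := (forall j, dotr (A i) u <= dotr (A j) u).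

Lemma minA_hull u : exists i, hull (G i) u /\ minA u i.
Proof.
have [i hi] := complete u; exists i; split=> // j; apply: inPF_hull hi.
by apply/inP_emb => k w kw; apply: nefa.
Qed.

(** The vertices on the face lie on one line of direction [w]. Those with least and largest pairing
    with [w] are the ends, since by [conv] and [conv_face] the face is spanned by its vertices. *)
Lemma face_segment (u w : 'rV[R]_n) i1 i2 :
  minA u i1 -> minA u i2 -> A i1 != A i2 ->
  (forall i j, minA u i -> minA u j -> exists s, A i - A j = s *: w) ->
  exists b c s, [/\ s != 0, A c - A b = s *: w, A b != A c, minA u b &
    face PA u = segment (A b) (A c)].
Proof.
move=> h1 h2 ne par.
pose P := [pred i | `[< minA u i >]].
have Pi1 : P i1 by apply/asboolP.
have Pi2 : P i2 by apply/asboolP.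
case: (@Order.TotalTheory.arg_minP _ _ _ i1 P (fun i => dotr (A i) w) Pi1) => b Pb hb.
case: (@Order.TotalTheory.arg_maxP _ _ _ i1 P (fun i => dotr (A i) w) Pi1) => c Pc hc.
have Mb := asboolW Pb; have Mc := asboolW Pc.
have ww : 0 < dotr w w.
  rewrite lt_def dotr_ge0 andbT dotr_eq0; apply: contra_neq ne => w0.
  by have [s /eqP] := par _ _ h1 h2; rewrite w0 scaler0 subr_eq0 => /eqP.
pose t i := dotr (A i - A b) w / dotr w w.
have tE i : P i -> A i - A b = t i *: w.
  by move=> /asboolW Pi; have [s e] := par _ _ Pi Mb; rewrite /t e dotrZl mulfK ?gt_eqF.
have t0 i : P i -> 0 <= t i <= t c.
  move=> Pi; apply/andP; split.
    by rewrite divr_ge0 ?(ltW ww)// dotrBl subr_ge0; apply: hb.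
  rewrite /t ler_pM2r ?invr_gt0//.
  by rewrite !dotrBl lerD2r; apply: hc.
have tb : t b = 0 by rewrite /t subrr dot0r mul0r.
have tc : 0 < t c.
  rewrite lt_def; have /andP[-> _] := t0 c Pc; rewrite andbT.
  apply: contra_neq ne => tc0.
  have z i : P i -> A i = A b.
    move=> Pi; apply/eqP; rewrite -subr_eq0 tE//.
    have : 0 <= t i <= t c by exact: t0.
    by rewrite tc0 -eq_le => /eqP<-; rewrite scale0r.
  by rewrite !z.
exists b, c, (t c); split=> //; first by rewrite gt_eqF.
- exact: tE.
- by rewrite eq_sym -subr_eq0 tE// scaler_eq0 gt_eqF//=; apply: contraTneq ww => ->; rewrite dot0r ltxx.
have aP i : inPF G a (A i) by apply/inP_emb => k x kx; apply: nefa.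
have [i0 [hi0 _]] := minA_hull u.
apply/seteqP; split=> x.
  case=> xP xmin; have [d [d0 d1 xE]] := conv complete xP.
  have xe : forall i, dotr x u <= dotr (A i) u by move=> i; apply: xmin; apply: aP.
  have dP i : d i != 0 -> P i.
    move=> di; apply/asboolP => j.
    by rewrite (conv_face d0 d1 xE xe di).
  have xE' : x = A b + (\sum_i d i * t i) *: w.
    rewrite xE scaler_suml -[A b]scale1r -d1 scaler_suml -big_split; apply: eq_bigr => i _ /=.
    have [->|/dP/tE e] := eqVneq (d i) 0; first by rewrite mul0r !scale0r addr0.
    by rewrite -scalerA -e -scalerDr addrC subrK.
  exists ((\sum_i d i * t i) / t c); last by rewrite tE// scalerA divfK ?gt_eqF.
  rewrite divr_ge0 ?(ltW tc) ?sumr_ge0//= => [|i _]; last first.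
    have [->|/dP/t0/andP[ti _]] := eqVneq (d i) 0; first by rewrite mul0r.
    exact: mulr_ge0.
  rewrite ler_pdivrMr// mul1r -[leRHS]mul1r -d1 mulr_suml ler_sum// => i _.
  have [->|/dP/t0/andP[_ ti]] := eqVneq (d i) 0; first by rewrite !mul0r.
  exact: ler_wpM2l.
case=> s /andP[s0 s1] ->; split.
  move=> i y iy; have hb' := aP b i y iy; have hc' := aP c i y iy.
  rewrite dotrDl dotrZl dotrBl; set p := dotr (A b) _ in hb' *; set q := dotr (A c) _ in hc' *.
  have -> : p + s * (q - p) = (1 - s) * p + s * q by ring.
  set k := dotr _ _ in hb' hc' *; nra.
move=> y yP; rewrite !dotE dotrDl dotrZl dotrBl.
have -> : dotr (A c) u = dotr (A b) u by apply/le_anti; rewrite Mb Mc.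
rewrite subrr mulr0 addr0; apply: le_trans (Mb i0) _; exact: inPF_hull yP hi0.
Qed.

Hypothesis noparallel : no_parallel_edges PA.

(* With w an edge direction of the common face of [v] and [v'], the point [zz] below
   is a perturbation of [u] inside the hyperplane orthogonal to w, where the face of
   [PA] is an edge parallel to w.  All these edges coincide, and any end of that edge
   gives the cone. *)
Lemma single_cone l v v' : nefd G l -> inP G l v -> inP G l v' -> v != v' ->
  exists i, forall j u, u \in G j ->
    dotr v u = dotr (l j) u -> dotr v' u = dotr (l j) u -> hull (G i) (emb R u).
Proof.
move=> nefl lv lv' vv'.
pose L i := emb R (l i); pose V := emb R v; pose V' := emb R v'.
have lP i : inPF G l (L i) by apply/inP_emb => k x kx; apply: nefl.
(* All generators on which [v] and [v'] are both minimal. *)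
pose us := flatten [seq [seq u <- G j | (dotr v u == dotr (l j) u) && (dotr v' u == dotr (l j) u)] | j <- enum 'I_r].
suff [i hi] : exists i, forall u, u \in us -> hull (G i) (emb R u).
  exists i => j u uj e e'; apply: hi; apply/flattenP.
  exists [seq u <- G j | (dotr v u == dotr (l j) u) && (dotr v' u == dotr (l j) u)].
    by apply/mapP; exists j; rewrite ?mem_enum.
  by rewrite mem_filter uj e e' !eqxx.
have usP u : u \in us -> dotr V' (emb R u) = dotr V (emb R u) /\
    forall i, dotr V (emb R u) <= dotr (L i) (emb R u).
  case/flattenP => ? /mapP[j _ ->]; rewrite mem_filter => /andP[/andP[/eqP e /eqP e'] uj].
  by split=> [|i]; rewrite /V /V' /L !dotr_emb e ?e' // ler_int; apply: nefl.
(* A vertex minimal at the sum [u0] is minimal at every member of [us]. *)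
pose u0 := \sum_(u <- us) emb R u.
have Vu0 i : dotr V u0 <= dotr (L i) u0.
  by rewrite !dotr_sumr big_seq [leRHS]big_seq ler_sum// => u /usP[].
have V'u0 : dotr V' u0 = dotr V u0.
  by rewrite !dotr_sumr big_seq [RHS]big_seq; apply: eq_bigr => u /usP[].
pose P := [pred i | dotr (L i) u0 == dotr V u0].
(* A face with a single vertex could not contain both [v] and [v']. *)
have [i1 [i2 [P1 P2 L12]]] : exists i1 i2, [/\ P i1, P i2 & L i1 != L i2].
  apply: contrapT => hn; move/eqP: vv'; apply; apply: (@emb_inj R).
  have [c [c0 c1 VE]] := conv complete (proj1 (@inP_emb _ _ _ R l v) lv).
  have [c' [c'0 c'1 V'E]] := conv complete (proj1 (@inP_emb _ _ _ R l v') lv').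
  have cP i : c i != 0 -> P i by move=> /(conv_face c0 c1 VE Vu0) /= ->.
  have c'P i : c' i != 0 -> P i.
    have V'u j : dotr V' u0 <= dotr (L j) u0 by rewrite V'u0.
    by move=> /(conv_face c'0 c'1 V'E V'u) /= ->; rewrite V'u0.
  have [i1 ci1] : exists i, c i != 0.
    apply: contrapT => h; move/eqP: c1; rewrite big1 => [|i _]; first by rewrite eq_sym oner_eq0.
    by apply: contrapT => /eqP ci; apply: h; exists i.
  have eL i : P i -> L i = L i1.
    by move=> Pi; apply: contrapT => /eqP ne; apply: hn; exists i, i1; split=> //; apply: cP.
  have E (d : 'I_r -> R) x : (forall i, d i != 0 -> P i) -> \sum_i d i = 1 ->
      x = \sum_i d i *: L i -> x = L i1.
    move=> dP d1 ->; rewrite -[RHS]scale1r -d1 scaler_suml; apply: eq_bigr => i _.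
    by have [->|/dP/eL->//] := eqVneq (d i) 0; rewrite !scale0r.
  by rewrite (E c _ cP c1 VE) (E c' _ c'P c'1 V'E).
pose DD := [seq L i - L j | i <- enum 'I_r, j <- enum 'I_r] ++
          [seq A i - A j | i <- enum 'I_r, j <- enum 'I_r].
have DL i j : L i - L j \in DD.
  by rewrite mem_cat; apply/orP; left; apply/allpairsP; exists (i, j); rewrite !mem_enum.
have DA i j : A i - A j \in DD.
  by rewrite mem_cat; apply/orP; right; apply/allpairsP; exists (i, j); rewrite !mem_enum.
have [p [q [z [Pp Pq Lqp [wz zP] zD]]]] := pivot DL P1 P2 L12.
set w := L q - L p in wz zD.
(* The point is zz = u + de u0 + e z. The term in [u0] cuts the minimal vertices L_i down to [P],
   the term in [z] keeps L_p and L_q minimal, and both coefficients are so small that the vertices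
   of [PA] minimal at zz are minimal at u. *)
have edges u : u \in us -> exists zz b c s, [/\ s != 0, A c - A b = s *: w, A b != A c &
    [/\ face PA zz = segment (A b) (A c), minA zz b &
    forall i, minA zz i -> minA (emb R u) i]].
  move=> /[dup] uus /usP[V'u Vu]; set U := emb R u in V'u Vu *.
  have PU i : P i -> dotr (L i) U = dotr V U.
    move=> /eqP; rewrite !dotr_sumr => /eqP; rewrite -subr_eq0 -sumrB big_seq.
    rewrite psumr_eq0 => [|x /usP[_ h]]; last by rewrite subr_ge0.
    by move=> /allP /(_ u uus); rewrite uus subr_eq0 => /eqP.
  have [de de0 hde] := small [seq (dotr (A i - A j) U, dotr (A i - A j) u0) | i <- enum 'I_r, j <- enum 'I_r].
  pose t := U + de *: u0.
  have tU i : minA t i -> minA U i.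
    move=> h j; rewrite leNgt -subr_gt0 -dotrBl; apply/negP => lt0.
    have := h j; rewrite leNgt -subr_gt0 -dotrBl dotrDr dotrZr => /negP; apply.
    apply: (hde _ _ (dotr (A i - A j) U, dotr (A i - A j) u0)) => //; first by rewrite lexx ltW.
    by apply/allpairsP; exists (i, j); rewrite !mem_enum.
  have [e e0 he] := small ([seq (dotr (A i - A j) t, dotr (A i - A j) z) | i <- enum 'I_r, j <- enum 'I_r] ++
      [seq (dotr (L i - L p) t, dotr (L i - L p) z) | i <- enum 'I_r]).
  pose zz := t + e *: z.
  have zt i : minA zz i -> minA t i.
    move=> h j; rewrite leNgt -subr_gt0 -dotrBl; apply/negP => lt0.
    have := h j; rewrite leNgt -subr_gt0 -dotrBl dotrDr dotrZr => /negP; apply.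
    apply: (he _ _ (dotr (A i - A j) t, dotr (A i - A j) z)) => //; first by rewrite lexx ltW.
    by rewrite mem_cat; apply/orP; left; apply/allpairsP; exists (i, j); rewrite !mem_enum.
  have Lp i : dotr (L p) zz <= dotr (L i) zz.
    rewrite -subr_ge0 -dotrBl dotrDr dotrZr.
    have LpU : 0 <= dotr (L i - L p) U by rewrite dotrBl (PU p)// subr_ge0.
    have Lpu0 : 0 <= dotr (L i - L p) u0 by rewrite dotrBl (eqP Pp) subr_ge0.
    have [t0|t0] := ltP 0 (dotr (L i - L p) t).
      apply/ltW/(he _ _ (dotr (L i - L p) t, dotr (L i - L p) z)) => //; first by rewrite lexx ltW.
      by rewrite mem_cat; apply/orP; right; apply/mapP; exists i; rewrite ?mem_enum.
    have Pi : P i.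
      rewrite /= -(eqP Pp) -subr_eq0 -dotrBl; move: t0; rewrite dotrDr dotrZr => t0.
      by rewrite eq_le Lpu0 andbT -(pmulr_rle0 _ de0); lra.
    have tge : 0 <= dotr (L i - L p) t by rewrite dotrDr dotrZr addr_ge0 // mulr_ge0// ltW.
    by rewrite addr_ge0// mulr_ge0 ?(ltW e0)// zP.
  have Lqz : dotr w zz = 0.
    rewrite dotrDr dotrZr wz mulr0 addr0 dotrDr dotrZr !dotrBl (eqP Pp) (eqP Pq) subrr mulr0 addr0.
    by rewrite !PU// subrr.
  have [i [hi mi]] := minA_hull zz.
  (* If A_i were the only minimal vertex of [PA] at zz, cone i would contain zz + eta w and zz - eta
     w. As L_i is minimal on that cone, <L_q,w> <= <L_i,w> <= <L_p,w>, contradicting <w,w> > 0. *)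
  have [k [mk Aik]] : exists k, minA zz k /\ A i != A k.
    apply: contrapT => hn.
    have [eta eta0 heta] := small ([seq (dotr (A j - A i) zz, dotr (A j - A i) w) | j <- enum 'I_r] ++
      [seq (dotr (A j - A i) zz, dotr (A j - A i) (- w)) | j <- enum 'I_r]).
    have hw w' : w' = w \/ w' = - w -> hull (G i) (zz + eta *: w').
      move=> hw'; apply: stricta => j; have [->//|Aj] := eqVneq (A j) (A i).
      rewrite -subr_ge0 -dotrBl dotrDr dotrZr ltW//.
      apply: (heta _ _ (dotr (A j - A i) zz, dotr (A j - A i) w')) => /=.
      - by rewrite lexx ltW.
      - rewrite mem_cat; apply/orP; case: hw' => ->; [left|right].
          by apply/mapP; exists j; rewrite ?mem_enum.
        by apply/mapP; exists j; rewrite ?mem_enum.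
      rewrite dotrBl subr_gt0 lt_neqAle mi andbT; apply/negP => /eqP eij; apply: hn.
      by exists j; split; [move=> k; rewrite -eij|rewrite eq_sym].
    have h1 := inPF_hull (lP p) (hw _ (or_introl erefl)).
    have h2 := inPF_hull (lP q) (hw _ (or_intror erefl)).
    have h3 := inPF_hull (lP p) hi.
    have h4 := Lp i.
    have Lqp' : dotr (L q) zz = dotr (L p) zz by apply/eqP; rewrite -subr_eq0 -dotrBl Lqz.
    have aux (y w' : 'rV[R]_n) : dotr y (zz + eta *: w') = dotr y zz + eta * dotr y w'.
      by rewrite dotrDr dotrZr.
    move: h1 h2; rewrite !aux !dotrNr -/(L i) Lqp' => h1 h2.
    have h5 : eta * dotr w w <= 0.
      by rewrite {1}/w dotrBl mulrBr; rewrite -/(L i) in h3; lra.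
    move: h5; rewrite pmulr_rle0// => h5.
    move: Lqp; rewrite -subr_eq0 -/w => /eqP; apply.
    by apply/eqP; rewrite -dotr_eq0 eq_le h5 dotr_ge0.
  have par i' j : minA zz i' -> minA zz j -> exists s, A i' - A j = s *: w.
    move=> mi' mj; apply: zD => //; have ti := zt _ mi'; have tj := zt _ mj.
    have e1 : dotr (A i' - A j) zz = 0.
      by apply/eqP; rewrite dotrBl subr_eq0 eq_le mi' mj.
    have e2 : dotr (A i' - A j) t = 0.
      by apply/eqP; rewrite dotrBl subr_eq0 eq_le ti tj.
    move/eqP: e1; rewrite dotrDr dotrZr e2 add0r mulf_eq0 gt_eqF//=.
    by move/eqP.
  have [b [c [s [s0 sE bc mb F]]]] := face_segment mi mk Aik par.
  exists zz, b, c, s; split=> //; split=> // j /zt/tU; exact.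
(* If [us] is empty any cone will do; otherwise the edge found for its first member is compared with
   all the others. *)
case: us usP edges {u0 Vu0 V'u0 P P1 P2 zP Pp Pq} => [|u1 us'] usP edges.
  by have [i _] := complete 0; exists i.
have [zz1 [b1 [c1 [s1 [s10 s1E bc1 [F1 mb1 h1]]]]]] := edges u1 (mem_head _ _).
exists b1 => u /edges [zz [b [c [s [s0 sE bc [F mb h]]]]]].
have eS : segment (A b1) (A c1) = segment (A b) (A c).
  apply: contrapT => ne; apply: (noparallel _ _ ne).
  - by split=> //; exists zz1.
  - by split=> //; exists zz.
  by exists (s1 / s); rewrite s1E sE scalerA divfK.
have : segment (A b) (A c) (A b1).
  by rewrite -eS; exists 0; rewrite ?lexx ?ler01// scale0r addr0.
(* The end b1 lies on the edge found for u, so it is minimal at zz and hence at u. *)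
rewrite -F => -[_ hb1]; apply: stricta; apply: h => j; apply: hb1.
by apply/inP_emb => k x kx; apply: nefa.
Qed.

End SingleCone.

(** * Bounding the lattice points that do not split *)

Section Bounded.
Variables (R : realType) (n r : nat) (G : 'I_r -> seq 'rV[int]_n).
Hypothesis complete : forall u : 'rV[R]_n, exists i, hull (G i) u.

Notation D := {ffun 'I_r -> 'rV[int]_n}.
Implicit Types (l : D) (m v : 'rV[int]_n).

Definition good l1 l2 m := exists x y, [/\ inP G l1 x, inP G l2 y & m = x + y].

Lemma good_sym l1 l2 m : good l1 l2 m -> good l2 l1 m.
Proof. by case=> x [y [hx hy ->]]; exists y, x; split=> //; rewrite addrC. Qed.

Lemma goodD l1 l2 m l1' l2' x y : good l1 l2 m -> inP G l1' x -> inP G l2' y ->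
  good (l1 + l1') (l2 + l2') (m + (x + y)).
Proof.
case=> x0 [y0 [hx0 hy0 ->]] hx hy; exists (x0 + x), (y0 + y).
by split; [exact: inPD|exact: inPD|rewrite addrACA].
Qed.

Lemma nefd_sum (T : Type) (s : seq T) (l : T -> D) (k : T -> nat) :
  (forall t, nefd G (l t)) -> nefd G (\sum_(t <- s) l t *+ k t).
Proof.
move=> h; apply/nefd_inP => i.
have -> : (\sum_(t <- s) l t *+ k t) i = \sum_(t <- s) l t i *+ k t.
  by rewrite sum_ffunE; apply: eq_bigr => t _; rewrite ffunMnE.
by apply: inP_sum => t; apply: inPMn; move/nefd_inP: (h t); apply.
Qed.

Hypothesis full : forall i (m : 'rV[int]_n), (forall u, u \in G i -> dotr m u = 0) -> m = 0.
Hypothesis cone_of : forall l v v', nefd G l -> inP G l v -> inP G l v' -> v != v' ->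
  exists i, forall j u, u \in G j ->
    dotr v u = dotr (l j) u -> dotr v' u = dotr (l j) u -> hull (G i) (emb R u).

(* Far along [v + v'] only the rays on which [v] and [v'] are both minimal matter;
   these lie in one cone, on which [l2] is linear. *)
Lemma absorb l1 l2 l m v v' : nefd G l2 -> nefd G l -> inP G (l1 + l2) m ->
  inP G l v -> inP G l v' -> v != v' ->
  exists k, good (l1 + l *+ k.*2) l2 (m + (v + v') *+ k).
Proof.
move=> nef2 nefl mP lv lv' vv'.
have [i hi] := cone_of nefl lv lv' vv'.
(* The bound k exceeds every possible deficit of m - l2_i against l1_j on a generator. *)
pose f j u := `|dotr (m - l2 i - l1 j) u|%N.
pose k := (\max_j \max_(u <- G j) f j u)%N.
exists k, (m + (v + v') *+ k - l2 i), (l2 i); split; last by rewrite subrK.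
  move=> j u uj.
  have fk : (f j u <= k)%N.
    apply: leq_trans (leq_bigmax j); exact: (@leq_bigmax_seq _ (G j) xpredT (f j)).
  have h1 := lv j u uj; have h2 := lv' j u uj.
  have h3 := mP j u uj; rewrite ffunE dotrDl in h3.
  rewrite ffunE ffunMnE !dotrDl dotrNl !dotrMnl dotrDl.
  rewrite /f !dotrBl in fk; rewrite -addnn mulrnDr -mulrnDl.
  (* Either both points are minimal at u, and then u lies in cone i; or, by integrality, each copy
     of v + v' gains at least 1, so k copies cover the deficit. *)
  have [s0|s0] := eqVneq (dotr v u + dotr v' u) (dotr (l j) u + dotr (l j) u).
    have hu : hull (G i) (emb R u) by apply: (hi j u uj); lia.
    have nP : inPF G l2 (emb R (l2 j)) by apply/inP_emb => p w pw; apply: nef2.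
    have := inPF_hull nP hu; rewrite !dotr_emb ler_int => h4.
    rewrite s0; move: (_ *+ k) => z; move: h3 h4; clear; lra.
  have s1 : dotr (l j) u + dotr (l j) u + 1 <= dotr v u + dotr v' u by lia.
  have : (dotr (l j) u + dotr (l j) u + 1) *+ k <= (dotr v u + dotr v' u) *+ k.
    by rewrite lerMn2r s1 orbT.
  rewrite (mulrnDl _ _ 1) natz; move: (_ *+ k) (_ *+ k) => z z' le.
  have fk' : - k%:Z <= dotr m u - dotr (l2 i) u - dotr (l1 j) u by lia.
  move: fk' h3 le; clear; lra.
by move/nefd_inP: nef2; apply.
Qed.

Lemma absorb_left l1 l2 la1 la2 m v1 v1' v2 v2' :
  nefd G l2 -> nefd G la1 -> inP G (l1 + l2) m ->
  inP G la1 v1 -> inP G la1 v1' -> inP G la2 v2 -> inP G la2 v2' -> v1 != v1' ->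
  exists k, good (l1 + la1 *+ k.*2) (l2 + la2 *+ k.*2)
    (m + ((v1 + v1') *+ k + (v2 + v2') *+ k)).
Proof.
move=> n2 nl mP h1 h1' h2 h2' ne; have [k g] := absorb n2 nl mP h1 h1' ne.
have q2 : inP G (la2 *+ k.*2) ((v2 + v2') *+ k).
  by rewrite -addnn mulrnDr mulrnDl; apply: inPD; apply: inPMn.
have q1 : inP G 0 0 by exact: inP0.
exists k; have := goodD g q1 q2.
by rewrite addr0 add0r -addrA.
Qed.

Lemma absorb_both l1 l2 la1 la2 m v1 v1' v2 v2' :
  nefd G l1 -> nefd G l2 -> nefd G la1 -> nefd G la2 -> inP G (l1 + l2) m ->
  inP G la1 v1 -> inP G la1 v1' -> inP G la2 v2 -> inP G la2 v2' ->
  v1 != v1' \/ v2 != v2' ->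
  exists k, good (l1 + la1 *+ k.*2) (l2 + la2 *+ k.*2)
    (m + ((v1 + v1') *+ k + (v2 + v2') *+ k)).
Proof.
move=> n1 n2 nl1 nl2 mP h1 h1' h2 h2' [ne|ne].
  exact: (absorb_left n2 nl1 mP h1 h1' h2 h2' ne).
rewrite addrC in mP; have [k g] := absorb_left n1 nl2 mP h2 h2' h1 h1' ne.
by exists k; rewrite [_ *+ k + _]addrC; apply: good_sym.
Qed.

Notation V := (D * D * 'rV[int]_n)%type.
Implicit Types (x : V).

(** The tags [Some true] and [Some false] stand for nefness of the first and the second bundle,
    [None] for membership of the point in the polytope of the product. *)
Definition slack (k : option bool) (i j : 'I_r) (u : 'rV[int]_n) (x : V) : int :=
  match k with
  | Some true => dotr (x.1.1 j - x.1.1 i) u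
  | Some false => dotr (x.1.2 j - x.1.2 i) u
  | None => dotr (x.2 - x.1.1 i - x.1.2 i) u
  end.

Lemma slackB k i j u x y : slack k i j u (x - y) = slack k i j u x - slack k i j u y.
Proof.
by case: k => [[]|]; rewrite /slack/= ?ffunE !(dotrBl, dotrDl, dotrNl); ring.
Qed.

Definition slacks : seq (V -> int) :=
  flatten [seq flatten [seq flatten [seq [seq slack k i j u | u <- G i] | j <- enum 'I_r]
    | i <- enum 'I_r] | k <- [:: None; Some true; Some false]].

Lemma slacksP f : f \in slacks <-> exists k i j u, u \in G i /\ f = slack k i j u.
Proof.
split=> [/flatten_mapP[k _ /flatten_mapP[i _ /flatten_mapP[j _ /mapP[u ui ->]]]]|].
  by exists k, i, j, u.
move=> [k [i [j [u [ui ->]]]]]; apply/flatten_mapP; exists k.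
  by case: k => [[]|].
apply/flatten_mapP; exists i; first by rewrite mem_enum.
apply/flatten_mapP; exists j; first by rewrite mem_enum.
by apply/mapP; exists u.
Qed.

Definition inS x := [/\ nefd G x.1.1, nefd G x.1.2 & inP G (x.1.1 + x.1.2) x.2].

Lemma inS_slacks x : inS x <-> forall f, f \in slacks -> 0 <= f x.
Proof.
split=> [[h1 h2 h3] f /slacksP[k [i [j [u [ui ->]]]]]|h].
  case: k => [[]|] /=; rewrite !dotrBl ?subr_ge0; [exact: h1|exact: h2|].
  by have := h3 i u ui; rewrite ffunE dotrDl; lra.
have H k i j u : u \in G i -> 0 <= slack k i j u x.
  by move=> ui; apply: h; apply/slacksP; exists k, i, j, u.
split=> [i j u /(H (Some true) i j)|i j u /(H (Some false) i j)|i u /(H None i i)];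
  rewrite /slack/= !dotrBl ?ffunE ?dotrDl; lra.
Qed.

(** Requiring both data to vanish on the cone [i0] removes the translations. The slacks then
    separate triples by [full], as [gordan] requires. *)
Lemma inS_generators (i0 : 'I_r) : exists (T : finType) (h : T -> V),
  (forall t, inS (h t)) /\
  forall x, inS x -> x.1.1 i0 = 0 -> x.1.2 i0 = 0 -> exists z : T -> nat, x = \sum_t h t *+ z t.
Proof.
pose P x := x.1.1 i0 = 0 /\ x.1.2 i0 = 0.
have [|x y [h1 h2] [h3 h4]|f|x [P1 P2] h|T [h [hS hx]]] := @gordan V P slacks.
- by split; rewrite /= ffunE.
- by split; rewrite /= !ffunE ?h1 ?h3 ?h2 ?h4 subrr.
- by move=> /slacksP[k [i [j [u [_ ->]]]]] x y; apply: slackB.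
- have H k j u : u \in G i0 -> slack k i0 j u x = 0.
    by move=> ui; apply: h; apply/slacksP; exists k, i0, j, u.
  have e1 : x.1.1 = 0.
    apply/ffunP => j; rewrite ffunE.
    have : x.1.1 j - x.1.1 i0 = 0 by apply: (full (i := i0)) => u /(H (Some true) j).
    by rewrite P1 subr0.
  have e2 : x.1.2 = 0.
    apply/ffunP => j; rewrite ffunE.
    have : x.1.2 j - x.1.2 i0 = 0 by apply: (full (i := i0)) => u /(H (Some false) j).
    by rewrite P2 subr0.
  have e3 : x.2 = 0.
    have : x.2 - x.1.1 i0 - x.1.2 i0 = 0 by apply: (full (i := i0)) => u /(H None i0).
    by rewrite P1 P2 !subr0.
  by move: e1 e2 e3; case: x {P1 P2 h H} => -[? ?] ? /= -> -> ->.
exists T, h; split=> [t|x /inS_slacks xS x1 x2]; first by apply/inS_slacks; case: (hS t).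
by apply: hx.
Qed.

End Bounded.

(** * Finitely many types of bad triples *)

Section Main.
Variables (R : realType) (n r : nat) (G : 'I_r -> seq 'rV[int]_n).
Hypothesis complete : forall u : 'rV[R]_n, exists i, hull (G i) u.

Notation D := {ffun 'I_r -> 'rV[int]_n}.
Notation V := (D * D * 'rV[int]_n)%type.
Implicit Types (l : D) (m v : 'rV[int]_n).
Hypothesis full : forall i (m : 'rV[int]_n), (forall u, u \in G i -> dotr m u = 0) -> m = 0.
Hypothesis cone_of : forall l v v', nefd G l -> inP G l v -> inP G l v' -> v != v' ->
  exists i, forall j u, u \in G j ->
    dotr v u = dotr (l j) u -> dotr v' u = dotr (l j) u -> hull (G i) (emb R u).

Definition goodV (x : V) := good G x.1.1 x.1.2 x.2.

Lemma fst_sumMn (T : finType) (h : T -> V) (z : T -> nat) :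
  [/\ (\sum_t h t *+ z t).1.1 = \sum_t (h t).1.1 *+ z t,
      (\sum_t h t *+ z t).1.2 = \sum_t (h t).1.2 *+ z t &
      (\sum_t h t *+ z t).2 = \sum_t (h t).2 *+ z t].
Proof.
have E (A : zmodType) (f : {additive V -> A}) :
    f (\sum_t h t *+ z t) = \sum_t f (h t) *+ z t.
  by rewrite raddf_sum; apply: eq_bigr => t _; rewrite raddfMn.
split; last exact: (E _ snd).
  by rewrite (E _ fst) raddf_sum /=; apply: eq_bigr => t _; rewrite raddfMn.
by rewrite (E _ fst) raddf_sum /=; apply: eq_bigr => t _; rewrite raddfMn.
Qed.

Section Types.
Variables (T : finType) (h : T -> V) (N : nat) (pa pb : T -> 'rV[int]_n).
Hypothesis hS : forall t, inS G (h t).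
Hypothesis paP : forall t, inP G ((h t).1.1 *+ N) (pa t).
Hypothesis pbP : forall t, inP G ((h t).1.2 *+ N) (pb t).
Hypothesis pE : forall t, (h t).2 *+ N = pa t + pb t.

Let X (z : T -> nat) : V := \sum_t h t *+ z t.

Lemma X_add z e k : X (fun t => z t + N * (k * e t))%N = X z + (\sum_t h t *+ N *+ e t) *+ k.
Proof.
rewrite -sumrMnl -big_split; apply: eq_bigr => t _ /=.
by rewrite mulrnDr -!mulrnA [(e t * k)%N]mulnC.
Qed.

(** All increments are multiples of N, and N times a generator splits by [pE]. *)
Lemma good_add z e k : goodV (X z) -> goodV (X (fun t => z t + N * (k * e t))%N).
Proof.
rewrite X_add /goodV; set Y := \sum_t _ => g /=.
have [e1 e2 e3] := fst_sumMn (fun t => h t *+ N) e.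
rewrite !raddfMn /=; set Y1 := Y.1.1; set Y2 := Y.1.2.
have -> : Y.2 = \sum_t pa t *+ e t + \sum_t pb t *+ e t.
  rewrite e3 -big_split; apply: eq_bigr => t _ /=.
  by rewrite -mulrnDl -pE; congr (_ *+ _); rewrite raddfMn.
rewrite mulrnDl; apply: goodD => //; apply: inPMn.
  rewrite /Y1 e1; apply: inP_sum => t; apply: inPMn; have := paP t.
  by rewrite (raddfMn fst) (raddfMn fst).
rewrite /Y2 e2; apply: inP_sum => t; apply: inPMn; have := pbP t.
by rewrite (raddfMn fst) (raddfMn snd).
Qed.

Lemma good_mono z y y' : (forall t, (y t <= y' t)%N) ->
  goodV (X (fun t => z t + N * y t)%N) -> goodV (X (fun t => z t + N * y' t)%N).
Proof.
move=> yy' /(good_add (fun t => y' t - y t)%N 1); congr (goodV (X _)).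
by apply/funext => t; rewrite mul1n -addnA -mulnDr subnKC.
Qed.

Lemma X_inS z : inS G (X z).
Proof.
have [e1 e2 e3] := fst_sumMn h z; split.
- by rewrite e1; apply: nefd_sum => t; case: (hS t).
- by rewrite e2; apply: nefd_sum => t; case: (hS t).
- rewrite e1 e2 e3 -big_split (eq_bigr (fun t => ((h t).1.1 + (h t).1.2) *+ z t)) => [|t _].
    by apply: inP_sum => t; apply: inPMn; case: (hS t).
  by rewrite mulrnDl.
Qed.

(** For each of the finitely many residue vectors [rho], goodness is upward closed in y by
    [good_mono], so [dickson] applies; the largest bound serves them all. *)
Lemma good_truncation : exists K, forall (rho : {ffun T -> 'I_N}) y,
  goodV (X (fun t => rho t + N * y t)%N) -> goodV (X (fun t => rho t + N * cap K y t)%N).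
Proof.
have hK (rho : {ffun T -> 'I_N}) : exists K, forall y,
    goodV (X (fun t => rho t + N * y t)%N) -> goodV (X (fun t => rho t + N * cap K y t)%N).
  apply: (@dickson T (fun y => goodV (X (fun t => rho t + N * y t)%N))) => y y'.
  exact: good_mono.
have [K hKr] := choice hK; exists (\max_rho K rho)%N => rho y /hKr.
apply: good_mono => t; rewrite /cap.
by have := leq_bigmax (F := K) rho; lia.
Qed.

(* Truncated at [K], the two vectors agree; the excesses are supported where
   the truncation is [K], so adding any multiple of them cannot make a bad vector
   good, whereas [absorb_both] does so when the excesses have the same degree. *)
Lemma same_type K z z' : (0 < N)%N ->
  (forall (rho : {ffun T -> 'I_N}) y, goodV (X (fun t => rho t + N * y t)%N) ->
     goodV (X (fun t => rho t + N * cap K y t)%N)) ->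
  (X z).1 = (X z').1 -> (forall t, z t = z' t %[mod N]) ->
  (forall t, minn (z t %/ N) K = minn (z' t %/ N) K) ->
  ~ goodV (X z) -> (X z).2 = (X z').2.
Proof.
move=> N0 hK e1 emod emin bad; apply: contrapT => ne; apply: bad.
pose rho : {ffun T -> 'I_N} := [ffun t => Ordinal (ltn_pmod (z t) N0)].
pose tau t := minn (z t %/ N) K.
pose e t := (z t %/ N - tau t)%N; pose e' t := (z' t %/ N - tau t)%N.
pose X0 := X (fun t => rho t + N * tau t)%N.
pose E f := \sum_t h t *+ N *+ f t.
have zE : X z = X0 + E e.
  rewrite -[E e]mulr1n -X_add; congr X; apply/funext => t; rewrite mul1n ffunE /=.
  by rewrite -addnA -mulnDr subnKC ?geq_minl// addnC mulnC -divn_eq.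
have z'E : X z' = X0 + E e'.
  rewrite -[E e']mulr1n -X_add; congr X; apply/funext => t; rewrite mul1n ffunE /=.
  rewrite -addnA -mulnDr subnKC; last by rewrite /tau emin geq_minl.
  by rewrite emod addnC mulnC -divn_eq.
suff [k gk] : exists k, goodV (X0 + E (fun t => e t + e' t)%N *+ k).
  move: gk; rewrite -X_add -/X.
  have -> : (fun t => rho t + N * tau t + N * (k * (e t + e' t)))%N =
      (fun t => rho t + N * (tau t + k * (e t + e' t)))%N.
    by apply/funext => t; rewrite -addnA -mulnDr.
  (* Where the excesses are not both zero [tau t] equals K, so truncation returns [tau] for every
     k. *)
  have capE : cap K (fun t => tau t + k * (e t + e' t))%N = tau.
    apply/funext => t; rewrite /cap /e /e'; have := emin t; rewrite -/(tau t).
    have [->|] := eqVneq (z t %/ N - tau t + (z' t %/ N - tau t))%N 0%N.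
      by rewrite muln0 addn0 => _; apply/minn_idPl; apply: geq_minr.
    move=> e0 et; have -> : tau t = K.
      by move: e0 et; rewrite /tau; move: (z t %/ N)%N (z' t %/ N)%N; clear; lia.
    by apply/minn_idPr; apply: leq_addr.
  move/hK; rewrite capE => g; suff -> : z = (fun t => rho t + N * (z t %/ N))%N.
    by apply: good_mono g => t; apply: geq_minl.
  by apply/funext => t; rewrite ffunE /= addnC mulnC -divn_eq.
pose A (p : T -> 'rV[int]_n) f := \sum_t p t *+ f t.
have ED f : (E f).2 = A pa f + A pb f.
  have [_ _ ->] := fst_sumMn (fun t => h t *+ N) f; rewrite -big_split.
  by apply: eq_bigr => t _; rewrite /= -mulrnDl -pE (raddfMn snd).
have E1 f : (E f).1.1 = \sum_t (h t).1.1 *+ N *+ f t.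
  have [-> _ _] := fst_sumMn (fun t => h t *+ N) f.
  by apply: eq_bigr => t _; rewrite !(raddfMn fst).
have E2 f : (E f).1.2 = \sum_t (h t).1.2 *+ N *+ f t.
  have [_ -> _] := fst_sumMn (fun t => h t *+ N) f.
  by apply: eq_bigr => t _; rewrite (raddfMn fst) (raddfMn snd).
have ee' : (E e).1 = (E e').1.
  by move: e1; rewrite zE z'E => /addrI.
have paA f : inP G (E f).1.1 (A pa f) by rewrite E1; apply: inP_sum => t; apply: inPMn.
have pbA f : inP G (E f).1.2 (A pb f) by rewrite E2; apply: inP_sum => t; apply: inPMn.
(* If both halves of the splittings agreed, so would the lattice points of X z and X z'. *)
have ab : A pa e != A pa e' \/ A pb e != A pb e'.
  apply: contrapT => /not_orP[/negP/negPn/eqP h1 /negP/negPn/eqP h2]; apply: ne.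
  by rewrite zE z'E /= !ED h1 h2.
have [n1 n2 mP] := X_inS (fun t => rho t + N * tau t)%N.
have nE1 : nefd G (E e).1.1.
  rewrite E1; apply: nefd_sum => t; case: (hS t) => n1t _ _.
  apply/nefd_inP => i; rewrite ffunMnE; apply: inPMn; move/nefd_inP: n1t; apply.
have nE2 : nefd G (E e).1.2.
  rewrite E2; apply: nefd_sum => t; case: (hS t) => _ n2t _.
  apply/nefd_inP => i; rewrite ffunMnE; apply: inPMn; move/nefd_inP: n2t; apply.
have pa' : inP G (E e).1.1 (A pa e') by rewrite ee'; apply: paA.
have pb' : inP G (E e).1.2 (A pb e') by rewrite ee'; apply: pbA.
have [k g] := absorb_both cone_of n1 n2 nE1 nE2 mP (paA e) pa' (pbA e) pb' ab.
exists k; move: g; rewrite /goodV.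
have -> : E (fun t => e t + e' t)%N = E e + E e'.
  by rewrite -big_split; apply: eq_bigr => t _; rewrite mulrnDr.
rewrite /= !raddfMn /= !ED -ee' -!mulr2n -!mulrnA mul2n.
by congr (good _ _ _ (_ + _)); rewrite -mulrnDl; congr (_ *+ _); rewrite addrACA.
Qed.

End Types.

(** The type of x records, for one chosen decomposition into generators, the multiplicities modulo N
    and their quotients truncated at K. *)
Lemma finite_types (i0 : 'I_r) : exists (T : finType) (ty : V -> T),
  forall x x', inS G x -> inS G x' -> x.1.1 i0 = 0 -> x.1.2 i0 = 0 -> x.1 = x'.1 ->
    ty x = ty x' -> ~ goodV x -> x.2 = x'.2.
Proof.
have [T [h [hS hX]]] := inS_generators full i0.
have sp t : exists Nab : nat * ('rV[int]_n * 'rV[int]_n),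
    [/\ (0 < Nab.1)%N, inP G ((h t).1.1 *+ Nab.1) Nab.2.1,
        inP G ((h t).1.2 *+ Nab.1) Nab.2.2 & (h t).2 *+ Nab.1 = Nab.2.1 + Nab.2.2].
  case: (hS t) => n1 n2 mP; have [N N0 [p [q [pP qP e]]]] := split_multiple complete n1 n2 mP.
  by exists (N, (p, q)).
have [f hf] := choice sp.
(* The product of the individual multiples works for all generators at once. *)
pose N := (\prod_t (f t).1)%N; pose M t := (\prod_(s | s != t) (f s).1)%N.
have NE t : N = ((f t).1 * M t)%N by rewrite /N (bigD1 t).
have N0 : (0 < N)%N by rewrite prodn_gt0// => t; case: (hf t).
pose pa t := (f t).2.1 *+ M t; pose pb t := (f t).2.2 *+ M t.
have paP t : inP G ((h t).1.1 *+ N) (pa t).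
  by rewrite (NE t) mulrnA; apply: inPMn; case: (hf t).
have pbP t : inP G ((h t).1.2 *+ N) (pb t).
  by rewrite (NE t) mulrnA; apply: inPMn; case: (hf t).
have pE t : (h t).2 *+ N = pa t + pb t.
  by rewrite (NE t) mulrnA -mulrnDl; case: (hf t) => _ _ _ ->.
have [K hK] := good_truncation paP pbP pE.
have [zf hz] : exists zf : V -> T -> nat, forall x, inS G x -> x.1.1 i0 = 0 -> x.1.2 i0 = 0 ->
    x = \sum_t h t *+ zf x t.
  suff /choice[zf] : forall x, exists z : T -> nat, inS G x -> x.1.1 i0 = 0 -> x.1.2 i0 = 0 ->
    x = \sum_t h t *+ z t by exists zf.
  move=> x; have [[xS x1 x2]|nx] := pselect ([/\ inS G x, x.1.1 i0 = 0 & x.1.2 i0 = 0]).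
    by have [z e] := hX x xS x1 x2; exists z.
  by exists (fun=> 0%N) => xS x1 x2; case: nx.
exists ({ffun T -> 'I_N} * {ffun T -> 'I_K.+1})%type.
exists (fun x => ([ffun t => Ordinal (ltn_pmod (zf x t) N0)],
                  [ffun t => Ordinal (geq_minr (zf x t %/ N) K : (minn (zf x t %/ N) K < K.+1)%N)])).
move=> x x' xS x'S x1 x2 xx' [ty1 ty2].
have xE := hz x xS x1 x2; have x'E := hz x' x'S.
rewrite xE x'E -?xx'//; apply: (same_type hS paP pbP pE N0 hK).
- by rewrite -xE -x'E -?xx'.
- by move=> t; move/ffunP/(_ t): ty1; rewrite !ffunE => /(congr1 val).
- by move=> t; move/ffunP/(_ t): ty2; rewrite !ffunE => /(congr1 val).
Qed.

(** For fixed bundles each type contains at most one bad point, so the number of types is a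
    bound. *)
Theorem bounded_nonsplit : exists N : nat, forall l1 l2, nefd G l1 -> nefd G l2 ->
  exists s : seq 'rV[int]_n, [/\ (size s <= N)%N, forall m, m \in s -> inP G (l1 + l2) m &
    forall m, inP G (l1 + l2) m -> ~ good G l1 l2 m -> m \in s].
Proof.
have [i0 _] := complete 0; have [T [ty hty]] := finite_types i0.
exists #|T| => l1 l2 n1 n2.
(* Subtracting constant data translates the polytopes and normalises both bundles at [i0] without
   affecting splitting. *)
pose cst (c : 'rV[int]_n) : D := [ffun=> c].
pose k1 := l1 - cst (l1 i0); pose k2 := l2 - cst (l2 i0).
have cP c : inP G (cst c) c by move=> i u _; rewrite ffunE.
have nefc c : nefd G (cst c) by move=> i j u _; rewrite !ffunE.
have cN c : - cst c = cst (- c) by apply/ffunP => i; rewrite !ffunE.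
have nk1 : nefd G k1 by rewrite /k1 cN; apply: nefdD.
have nk2 : nefd G k2 by rewrite /k2 cN; apply: nefdD.
pose nm (m : 'rV[int]_n) : V := ((k1, k2), m - l1 i0 - l2 i0).
have shift (l : D) c m : inP G l m -> inP G (l - cst c) (m - c).
  by move=> lm; rewrite cN; apply: inPD.
have inSn m : inP G (l1 + l2) m -> inS G (nm m).
  move=> mP; split=> //=; rewrite /k1 /k2 addrACA -opprD -[_ - _ - _]addrA -opprD.
  have -> : cst (l1 i0) + cst (l2 i0) = cst (l1 i0 + l2 i0) by apply/ffunP => i; rewrite !ffunE.
  exact: shift.
have bad m : ~ good G l1 l2 m -> ~ goodV (nm m).
  move=> nb g; apply: nb.
  have := goodD g (cP (l1 i0)) (cP (l2 i0)); rewrite /= !subrK.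
  by rewrite -[m - _ - _]addrA -opprD subrK.
have [g hg] : exists g : T -> option 'rV[int]_n, forall t,
    (forall m, g t = Some m -> inP G (l1 + l2) m) /\
    (forall m, inP G (l1 + l2) m -> ~ good G l1 l2 m -> ty (nm m) = t -> g t = Some m).
  suff /choice[g] : forall t, exists o, (forall m, o = Some m -> inP G (l1 + l2) m) /\
    (forall m, inP G (l1 + l2) m -> ~ good G l1 l2 m -> ty (nm m) = t -> o = Some m) by exists g.
  move=> t; have [[m [mP mb mt]]|nm'] := pselect (exists m, [/\ inP G (l1 + l2) m,
      ~ good G l1 l2 m & ty (nm m) = t]).
    exists (Some m); split=> [m' [<-]//|m' m'P m'b m't]; congr Some.
    have z0 (l : D) : (l - cst (l i0)) i0 = 0 by rewrite !ffunE subrr.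
    have := hty _ _ (inSn m mP) (inSn m' m'P) (z0 l1) (z0 l2) erefl _ (bad m mb).
    by rewrite mt m't => /(_ erefl) /= /addIr /addIr.
  by exists None; split=> // m mP mb mt; case: nm'; exists m.
exists (pmap g (enum T)); split.
- by rewrite size_pmap cardT; apply: leq_trans (count_size _ _) _; rewrite size_map.
- move=> m; rewrite mem_pmap => /mapP[t _ e]; case: (hg t) => h _; exact: h.
- move=> m mP mb; rewrite mem_pmap; apply/mapP; exists (ty (nm m)); first by rewrite mem_enum.
  by case: (hg (ty (nm m))) => _ /(_ m mP mb erefl) ->.
Qed.

End Main.

(** * The places of k(t) *)

Section Fractions.
Variable A : idomainType.

Lemma fracE (x : {fraction A}) :
  exists pq : A * A, pq.2 != 0 /\ x = tofrac pq.1 / tofrac pq.2.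
Proof.
elim/quotW: x => x; exists (\n_x, \d_x); split; first exact: denom_ratioP.
rewrite /GRing.mul /= /GRing.inv /= !piE /FracField.mulf /FracField.invf.
rewrite !numden_Ratio ?oner_eq0 ?denom_ratioP//.
by rewrite mulr1 mul1r Ratio_numden.
Qed.

End Fractions.

Section Places.
Variable k : closedFieldType.
Notation K := ({fraction {poly k}} : fieldType).
Definition const_frac : {rmorphism k -> K} := (@tofrac {poly k} \o polyC : {rmorphism k -> K}).
Notation "p %:F" := (@tofrac {poly k} p : K) (at level 1, format "p %:F").
Notation t := (('X : {poly k})%:F).

Lemma t_neq0 : t != 0.
Proof. by rewrite tofrac_eq0 polyX_eq0. Qed.

Lemma horner_map_const (p : {poly k}) : (map_poly const_frac p).[t] = p%:F.
Proof.
rewrite (map_poly_comp (@tofrac {poly k}) polyC) horner_map /=.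
congr (_ %:F); exact: comp_polyXr.
Qed.

Lemma function_field_fraction : function_field1 const_frac.
Proof.
exists t; split=> [p p0|]; first by rewrite horner_map_const tofrac_eq0.
exists [:: 1] => x; have [[p q] /= [q0 ->]] := fracE x.
exists q, (fun=> p); split=> //; rewrite !horner_map_const big_ord1 mulr1.
by rewrite mulrC divfK// tofrac_eq0.
Qed.

Lemma mupX : mup 0 ('X : {poly k}) = 1%N.
Proof. by rewrite -['X]subr0 -polyC0 -[_ - _]expr1 mup_XsubCX eqxx. Qed.

Lemma mup0C (c : k) : c != 0 -> mup 0 c%:P = 0%N.
Proof. by move=> c0; rewrite mupNroot// rootC. Qed.

Section PlaceTheory.
Variable v : K -> int.
Hypothesis vP : place const_frac v.

Lemma placeM x y : x != 0 -> y != 0 -> v (x * y) = v x + v y.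
Proof. by case: vP => _ h _ _ _; apply: h. Qed.

Lemma place1 : v 1 = 0.
Proof.
by have := @placeM 1 1 (oner_neq0 _) (oner_neq0 _); rewrite mulr1; lia.
Qed.

Lemma placeV x : x != 0 -> v x^-1 = - v x.
Proof.
move=> x0; have := @placeM x x^-1 x0; rewrite invr_eq0 => /(_ x0).
by rewrite divff// place1; lia.
Qed.

Lemma placeX x i : x != 0 -> v (x ^+ i) = v x *+ i.
Proof.
move=> x0; elim: i => [|i IH]; first by rewrite place1.
by rewrite exprS placeM ?expf_neq0// IH mulrS.
Qed.

Lemma placeXz x (z : int) : x != 0 -> v (x ^ z) = z * v x.
Proof.
move=> x0; case: z => i.
  by rewrite -exprnP placeX// -mulr_natl natz.
by rewrite NegzE -exprnN placeV ?expf_neq0// placeX// mulNr -mulr_natl natz.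
Qed.

Lemma place_const c : c != 0 -> v c%:P%:F = 0.
Proof. by case: vP => _ _ _ h _; apply: h. Qed.

Lemma place_min x y : x != 0 -> y != 0 -> x + y != 0 -> Num.min (v x) (v y) <= v (x + y).
Proof. by case: vP => _ _ h _ _; apply: h. Qed.

Lemma placeN x : x != 0 -> v (- x) = v x.
Proof.
move=> x0; rewrite -mulN1r placeM ?oppr_eq0 ?oner_eq0//.
have := place_const (c := -1); rewrite polyCN rmorphN rmorph1 oppr_eq0 oner_eq0.
by move=> ->//; rewrite add0r.
Qed.

Lemma placeD_lt x y : x != 0 -> y != 0 -> v x < v y -> x + y != 0 /\ v (x + y) = v x.
Proof.
move=> x0 y0 xy; have xy0 : x + y != 0.
  by apply: contraTneq xy => /addr0_eq <-; rewrite (placeN x0) ltxx.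
split=> //; have := place_min x0 y0 xy0.
have := place_min xy0 (_ : - y != 0); rewrite addrK oppr_eq0 => /(_ y0 x0).
rewrite (placeN y0) !ge_min => le1 le2; apply/le_anti.
have {}le2 : v x <= v (x + y) by case/orP: le2 => // /(lt_le_trans xy)/ltW.
by rewrite le2 andbT; move: le1; rewrite [v y <= v x]leNgt xy orbF.
Qed.

(** Induction along Horner's scheme: a nonzero constant term has value 0, strictly below that of the
    rest. *)
Lemma place_pos p : 0 < v t -> p != 0 -> v p%:F = (mup 0 p)%:Z * v t.
Proof.
move=> vt; elim/poly_ind: p => [|p c IH]; first by rewrite eqxx.
have [->|p0 _] := eqVneq p 0.
  rewrite mul0r add0r polyC_eq0 => c0; rewrite place_const// mupNroot ?mul0r//.
  by rewrite rootC.
have vpX : v (p * 'X)%:F = (mup 0 p).+1%:Z * v t.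
  rewrite rmorphM placeM ?tofrac_eq0 ?polyX_eq0// IH//; first by rewrite intS mulrDl mul1r addrC.
have [->|c0] := eqVneq c 0.
  by rewrite addr0 vpX mupM ?polyX_eq0// mupX addn1.
rewrite mupNroot; last by rewrite /root hornerD hornerMX mulr0 add0r hornerC.
rewrite mul0r addrC rmorphD.
have [|||_ ->] := @placeD_lt c%:P%:F (p * 'X)%:F.
- by rewrite tofrac_eq0 polyC_eq0.
- by rewrite tofrac_eq0 mulf_neq0 ?polyX_eq0.
- by rewrite place_const// vpX mulr_gt0.
- by rewrite place_const.
Qed.

(** Here it is the leading term that has the strictly smallest value. *)
Lemma place_neg p : v t < 0 -> p != 0 -> v p%:F = (size p).-1%:Z * v t.
Proof.
move=> vt; elim/poly_ind: p => [|p c IH]; first by rewrite eqxx.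
have [->|p0 _] := eqVneq p 0.
  rewrite mul0r add0r polyC_eq0 => c0; rewrite place_const// size_polyC c0; lia.
have vpX : v (p * 'X)%:F = (size p)%:Z * v t.
  rewrite rmorphM placeM ?tofrac_eq0 ?polyX_eq0// IH//.
  by rewrite -{2}[v t]mul1r -mulrDl; have := p0; rewrite -size_poly_gt0 => sp; congr (_ * _); lia.
rewrite size_MXaddC (negPf p0) /=.
have [->|c0] := eqVneq c 0; first by rewrite addr0.
rewrite rmorphD.
have [|||_ ->//] := @placeD_lt (p * 'X)%:F c%:P%:F.
- by rewrite tofrac_eq0 mulf_neq0 ?polyX_eq0.
- by rewrite tofrac_eq0 polyC_eq0.
- by rewrite place_const// vpX pmulr_rlt0// ltz_nat size_poly_gt0.
Qed.

End PlaceTheory.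

Lemma place_ext v v' : place const_frac v -> place const_frac v' ->
  (forall p : {poly k}, p != 0 -> v p%:F = v' p%:F) -> v = v'.
Proof.
move=> vP v'P h; apply/funext => x; have [->|x0] := eqVneq x 0.
  by case: vP => -> _ _ _ _; case: v'P => -> _ _ _ _.
have [[p q] /= [q0 xE]] := fracE x.
have p0 : p != 0 by apply: contraNneq x0 => p0; rewrite xE p0 rmorph0 mul0r.
rewrite xE (placeM vP) ?(placeM v'P) ?invr_eq0 ?tofrac_eq0//.
by rewrite (placeV vP) ?(placeV v'P) ?tofrac_eq0// !h.
Qed.

(** All values of [v] are multiples of a, and a place takes the value 1. *)
Lemma place_gcd v (f : {poly k} -> nat) (a : int) : place const_frac v ->
  (forall p : {poly k}, p != 0 -> v p%:F = (f p)%:Z * a) -> `|a| = 1.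
Proof.
move=> vP h; have [_ _ _ _ [x x0 x1]] := vP.
have [[p q] /= [q0 xE]] := fracE x.
have p0 : p != 0 by apply: contraNneq x0 => p0; rewrite xE p0 rmorph0 mul0r.
move: x1; rewrite xE (placeM vP) ?invr_eq0 ?tofrac_eq0// (placeV vP) ?tofrac_eq0//.
rewrite !h// -mulrBl => e; have := dvdz_mull ((f p)%:Z - (f q)%:Z) (dvdzz a); rewrite e dvdz1.
by move=> /eqP a1; rewrite -abszE a1.
Qed.

Section Extend.
Variable f : {poly k} -> int.
Hypothesis fM : forall p q, p != 0 -> q != 0 -> f (p * q) = f p + f q.
Hypothesis fD : forall p q, p != 0 -> q != 0 -> p + q != 0 -> Num.min (f p) (f q) <= f (p + q).
Hypothesis fC : forall c, c != 0 -> f c%:P = 0.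

Let numden (x : K) := cid (fracE x).
Definition extend (x : K) : int :=
  if x == 0 then 0 else f (projT1 (numden x)).1 - f (projT1 (numden x)).2.

(** Two representations of a fraction have equal cross products, so by [fM] the difference does not
    depend on the one chosen. *)
Lemma extendE p q : p != 0 -> q != 0 -> extend (p%:F / q%:F) = f p - f q.
Proof.
move=> p0 q0; rewrite /extend mulf_eq0 invr_eq0 !tofrac_eq0 (negPf p0) (negPf q0) /=.
case: (numden _) => -[p' q'] /= [q'0 e].
have p'0 : p' != 0.
  apply: contraNneq p0 => p'0; move: e; rewrite p'0 rmorph0 mul0r => /eqP.
  by rewrite mulf_eq0 invr_eq0 !tofrac_eq0 (negPf q0) orbF.
have : p * q' = p' * q.
  apply/eqP; rewrite -tofrac_eq !rmorphM /= -eqr_div ?tofrac_eq0// e//.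
move/(congr1 f); rewrite !fM//; lia.
Qed.

Lemma extend_poly p : p != 0 -> extend p%:F = f p.
Proof.
move=> p0; have := extendE p0 (oner_neq0 _); rewrite rmorph1 divr1 => ->.
by rewrite (_ : 1 = 1%:P)// fC ?oner_eq0// subr0.
Qed.

Lemma extend_place x1 : x1 != 0 -> extend x1 = 1 -> place const_frac extend.
Proof.
have nz x : x != 0 -> exists p q, [/\ p != 0, q != 0 & x = p%:F / q%:F].
  have [[p q] /= [q0 ->]] := fracE x => x0; exists p, q; split=> //.
  by apply: contraNneq x0 => ->; rewrite rmorph0 mul0r.
move=> x10 h1; split; first by rewrite /extend eqxx.
- move=> x y /nz[p [q [p0 q0 ->]]] /nz[p' [q' [p'0 q'0 ->]]].
  rewrite mulf_div -!rmorphM !extendE ?mulf_neq0// !fM//; lia.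
- move=> x y /nz[p [q [p0 q0 ->]]] /nz[p' [q' [p'0 q'0 ->]]].
  rewrite addf_div ?tofrac_eq0// -!rmorphM -rmorphD.
  rewrite mulf_eq0 tofrac_eq0 => /norP[s0 _]; rewrite !extendE ?mulf_neq0//.
  have := fD (mulf_neq0 p0 q'0) (mulf_neq0 p'0 q0) s0; rewrite !fM// !ge_min.
  move: (f (_ + _)) (f p) (f q) (f p') (f q'); clear => a b c d e.
  by case/orP => le; apply/orP; [left|right]; lia.
- by move=> c c0; rewrite /= extend_poly ?polyC_eq0// fC.
- by exists x1.
Qed.

End Extend.

Definition ord0 := extend (fun p => (mup 0 p)%:Z).
Definition ordoo := extend (fun p => - (size p).-1%:Z).

Lemma ord0_poly p : p != 0 -> ord0 p%:F = mup 0 p.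
Proof.
apply: extend_poly => [q q' q0 q'0|c c0]; last by rewrite mup0C.
by rewrite mupM.
Qed.

Lemma ord0_place : place const_frac ord0.
Proof.
apply: (@extend_place _ _ _ _ t); last by rewrite -/ord0 ord0_poly ?polyX_eq0// mupX.
- by move=> p q p0 q0; rewrite mupM.
- move=> p q p0 q0 pq0; rewrite ge_min !lez_nat -geq_min.
  by rewrite mup_geq// dvdp_add// -mup_geq// ?geq_minl ?geq_minr.
- by move=> c c0; rewrite mup0C.
- exact: t_neq0.
Qed.

Lemma degM (p q : {poly k}) : p != 0 -> q != 0 ->
  - (size (p * q)).-1%:Z = - (size p).-1%:Z + - (size q).-1%:Z.
Proof.
move=> p0 q0; rewrite size_mul//; move: p0 q0; rewrite -!size_poly_gt0.
by move: (size p) (size q) => a b; clear; lia.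
Qed.

Lemma ordoo_poly p : p != 0 -> ordoo p%:F = - (size p).-1%:Z.
Proof.
by apply: extend_poly => [q q' q0 q'0|c c0]; [apply: degM|rewrite size_polyC c0].
Qed.

Lemma ordoo_place : place const_frac ordoo.
Proof.
apply: (@extend_place _ degM _ _ t^-1).
- move=> p q p0 q0 pq0; have := size_polyD p q; rewrite leq_max ge_min.
  move: (size (p + q)) (size p) (size q) => a b c; clear.
  by case/orP => le; apply/orP; [left|right]; lia.
- by move=> c c0; rewrite size_polyC c0.
- by rewrite invr_eq0 t_neq0.
- have := @extendE _ degM 1 'X (oner_neq0 _); rewrite polyX_eq0 rmorph1 div1r => -> //.
  by rewrite size_poly1 size_polyX.
Qed.

(** The curves below are given by powers of t, so only the places at 0 and infinity can contribute
    to a degree. *)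
Lemma place_t v : place const_frac v ->
  [\/ v t = 0, v = ord0 /\ v t = 1 | v = ordoo /\ v t = -1].
Proof.
move=> vP; have [vt|vt|vt] := ltgtP (v t) 0; last by constructor 1.
- have h p := place_neg vP (p := p) vt.
  have a1 := place_gcd vP h; have vt1 : v t = -1 by lia.
  constructor 3; split=> //; apply: place_ext => // [|p p0]; first exact: ordoo_place.
  by rewrite h// vt1 ordoo_poly// mulrN1.
- have h p := place_pos vP (p := p) vt.
  have a1 := place_gcd vP h; have vt1 : v t = 1 by lia.
  constructor 2; split=> //; apply: place_ext => // [|p p0]; first exact: ord0_place.
  by rewrite h// vt1 ord0_poly// mulr1.
Qed.

Lemma ord0_t : ord0 t = 1.
Proof. by rewrite ord0_poly ?polyX_eq0// mupX. Qed.

Lemma ordoo_t : ordoo t = -1.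
Proof. by rewrite ordoo_poly ?polyX_eq0// size_polyX. Qed.

End Places.

(** * Nefness along a segment of N_R *)

Lemma dot_toR (R : realType) n (m w : 'rV[int]_n) :
  dotr (toR R m) (toR R w) = (dotr m w)%:~R.
Proof. exact: dotr_emb. Qed.

Section Step.
Variables (R : realType) (k : closedFieldType) (n : nat) (X : fan R n).
Notation K := ({fraction {poly k}} : fieldType).
Notation t := (@tofrac {poly k} 'X : K).

Lemma fan_setI s s' : X s -> X s' -> X (s `&` s')%classic.
Proof. by move=> Xs Xs'; have [f _] := fan_inter Xs Xs'; apply: fan_face f. Qed.

Section Curve.
Variables (s s' : set 'rV[R]_n) (w : 'rV[int]_n) (x0 : 'rV[R]_n) (e e' : R).
Hypotheses (Xs : X s) (Xs' : X s') (sx : s x0) (s'x : s' x0).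
Hypotheses (e0 : 0 < e) (e'0 : 0 < e').
Hypothesis s'e : s' (x0 + e *: toR R w).
Hypothesis se : s (x0 - e' *: toR R w).

(** The one-parameter subgroup of [w] acting on a point of the orbit of [tau]: characters pull back
    to powers of t, the point t = 0 goes to the chart of s' and t = infinity to the chart of s. *)
Let tau := (s `&` s')%classic.
Let hom (m : 'rV[int]_n) : K := t ^ (dotr m w).
Let centre (v : K -> int) := if 0 < v t then s' else if v t < 0 then s else tau.

Lemma step_hom_neq0 m : orth tau (toR R m) -> hom m != 0.
Proof. by move=> _; rewrite expfz_neq0// t_neq0. Qed.

Lemma step_homD m m' : orth tau (toR R m) -> orth tau (toR R m') -> hom (m + m') = hom m * hom m'.
Proof. by move=> _ _; rewrite /hom dotrDl expfzDr// t_neq0. Qed.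

Lemma step_centre_fan v : place (const_frac k) v -> X (centre v) /\ (tau `<=` centre v)%classic.
Proof.
move=> _; rewrite /centre; case: ifP => _; first by split=> // x [].
case: ifP => _; first by split=> // x [].
by split=> //; apply: fan_setI.
Qed.

(** A character orthogonal to [tau] vanishes at [x0], so its sign on [w] can be read off at x0 + e w
    in s' and at x0 - e' w in s. *)
Lemma step_centre_chart v : place (const_frac k) v -> forall m,
  orth tau (toR R m) -> dual_cone (centre v) (toR R m) -> 0 <= v (hom m).
Proof.
move=> vP m om; rewrite /hom (placeXz vP)// ?t_neq0//.
have mx0 : dotr (toR R m) x0 = 0 by apply: om.
rewrite /centre; case: ltgtP => [vt|vt|vt] h; last by rewrite -vt mulr0.
  have := h _ s'e; rewrite dotE dotrDr dotrZr mx0 add0r dot_toR.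
  by rewrite pmulr_rge0// ler0z => mw; rewrite mulr_ge0// ltW.
have := h _ se; rewrite dotE dotrBr dotrZr mx0 sub0r dot_toR.
rewrite oppr_ge0 pmulr_rle0// lerz0 => mw; rewrite mulr_le0// ltW//.
Qed.

Definition step_curve : curve k X :=
  @Curve R k n X K (const_frac k) (function_field_fraction k) tau (fan_setI Xs Xs')
    hom step_hom_neq0 step_homD centre step_centre_fan step_centre_chart.

Lemma degree_step (L : line_bundle X) : degree L step_curve = dotr (L s - L s') w.
Proof.
rewrite /degree /=.
have V v : place (const_frac k) v ->
    v (hom (L tau - L (centre v))) = dotr (L tau - L (centre v)) w * v t.
  by move=> vP; rewrite /hom (placeXz vP)// t_neq0.
have P0 := ord0_place k; have Poo := ordoo_place k.
(* The places at 0 and infinity contribute with opposite signs, so L tau cancels. *)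
rewrite (@fsbigE _ _ _ _ _ [:: @ord0 k; @ordoo k]) /=.
- rewrite !big_cons big_nil !ifT ?inE// !V// ord0_t ordoo_t /centre ord0_t ordoo_t /=.
  rewrite !dotrBl; ring.
- rewrite inE andbT; apply/negP => /eqP h.
  by have := ord0_t k; rewrite h ordoo_t.
- by move=> v /=; rewrite !inE => /orP[] /eqP ->.
- move=> v vP; rewrite !inE => /norP[/eqP n0 /eqP noo]; rewrite V//.
  by have [->|[]|[]] := place_t vP; rewrite ?mulr0.
Qed.

End Curve.

Lemma nef_step (L : line_bundle X) (s s' : set 'rV[R]_n) w x0 (e e' : R) :
  nef k L -> X s -> X s' -> s x0 -> s' x0 -> 0 < e -> 0 < e' ->
  s' (x0 + e *: toR R w) -> s (x0 - e' *: toR R w) ->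
  dotr (L s') w <= dotr (L s) w.
Proof.
move=> nefL Xs Xs' sx s'x e0 e'0 s'e se.
have := nefL (step_curve Xs Xs' sx s'x e0 e'0 s'e se).
by rewrite degree_step dotrBl subr_ge0.
Qed.

End Step.

(** Applied to the inequalities of a cone, b' is the last time up to 1 at which the segment is in
    it. A new inequality violated at the old exit time moves the exit to its zero. *)
Lemma segment_exit (F : realFieldType) (s : seq (F * F)) (b : F) : b <= 1 ->
  (forall p, p \in s -> 0 <= p.1 + b * p.2) ->
  exists b', [/\ b <= b' <= 1, forall p, p \in s -> 0 <= p.1 + b' * p.2 &
    forall t, b' < t <= 1 -> ~ forall p, p \in s -> 0 <= p.1 + t * p.2].
Proof.
move=> b1; elim: s => [|[p q] s IH] h.
  exists 1; split=> //; first by rewrite b1 lexx.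
  by move=> t /andP[t1 t2]; have := lt_le_trans t1 t2; rewrite ltxx.
have [p' p's|b0 [/andP[bb0 b01] h0 hn]] := IH; first by apply: h; rewrite inE p's orbT.
have hb : 0 <= p + b * q by apply: (h (p, q)); rewrite mem_head.
have [pq|pq] := leP 0 (p + b0 * q).
  exists b0; split; first by rewrite bb0.
    by move=> p'; rewrite inE => /predU1P[->|/h0].
  by move=> t /hn nt ht; apply: nt => p' p's; apply: ht; rewrite inE p's orbT.
have q0 : q < 0 by nra.
have rE : - p / q * q = - p by rewrite divfK// lt_eqF.
move: rE; set r := - p / q => rE.
have br : b <= r by rewrite -(ler_nM2r q0); lra.
have rb : r <= b0 by rewrite -(ler_nM2r q0); lra.
exists r; split.
- by rewrite br; apply: le_trans rb b01.
- move=> p'; rewrite inE => /predU1P[->/=|p's]; first by rewrite rE subrr.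
  have := h0 _ p's; have := h p'; rewrite inE p's orbT => /(_ erefl).
  by case: p' {p's} => u v /=; case: (ltgtP v 0) => [v0|v0|->] h1 h2; nra.
- move=> t /andP[rt _] /(_ (p, q) (mem_head _ _)) /=.
  have : t * q < r * q by rewrite ltr_nM2r.
  by rewrite rE => ? ?; lra.
Qed.

(** * Full-dimensional cones of a complete fan *)

Section Fan.
Variables (R : realType) (n : nat) (X : fan R n).
Hypothesis Xcomplete : complete_fan X.
Implicit Types (s : set 'rV[R]_n).

Lemma fan_data : exists (cs : seq (set 'rV[R]_n)) (gen ms : set 'rV[R]_n -> seq 'rV[int]_n),
  [/\ forall s, X s <-> s \in cs, forall s, X s -> s = hull (gen s) &
      forall s, X s -> forall u, s u <-> forall m, m \in ms s -> 0 <= dotr (emb R m) u].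
Proof.
have /finite_seqP[cs csE] := fan_finite X.
have [gen hgen] : exists gen : set 'rV[R]_n -> seq 'rV[int]_n, forall s, X s -> s = hull (gen s).
  suff /choice[gen] : forall s, exists g : seq 'rV[int]_n, X s -> s = hull g by exists gen.
  by move=> s; have [/(@fan_rational _ _ X)[g ->]|] := pselect (X s); [exists g|exists [::]].
have [ms hms] : exists ms : set 'rV[R]_n -> seq 'rV[int]_n, forall s, X s ->
    forall u, s u <-> forall m, m \in ms s -> 0 <= dotr (emb R m) u.
  suff /choice[ms] : forall s, exists ms : seq 'rV[int]_n, X s ->
    forall u, s u <-> forall m, m \in ms -> 0 <= dotr (emb R m) u by exists ms.
  move=> s; have [ms h] := weyl (gen s); exists ms => Xs u.
  by rewrite [s in s u]hgen//; apply: h.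
by exists cs, gen, ms; split=> // s; rewrite csE.
Qed.

Lemma cone_convex s u v (a b : R) : X s -> s u -> s v -> 0 <= a -> 0 <= b -> s (a *: u + b *: v).
Proof.
by move=> /(@fan_rational _ _ X)[g ->] su sv a0 b0; apply: hullD; apply: hullZ.
Qed.

(** For small d, the inequalities of all cones that fail at u also fail at u + d x; so any cone
    containing u + d x contains u. *)
Lemma local_cone (u x : 'rV[R]_n) : exists s, [/\ X s, s u & exists2 d, 0 < d & s (u + d *: x)].
Proof.
have [cs [gen [ms [csP _ msP]]]] := fan_data.
pose all := flatten [seq ms s | s <- cs].
have [e e0 he] := small [seq (- dotr (emb R m) u, - dotr (emb R m) x) | m <- all].
have [s Xs su] := Xcomplete (u + e *: x).
exists s; split=> //; last by exists e.
apply/(msP _ Xs) => m ms_m; rewrite leNgt; apply/negP => mu.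
have /(msP _ Xs) /(_ _ ms_m) := su; rewrite leNgt => /negP; apply.
rewrite dotrDr dotrZr -oppr_gt0 opprD -mulrN.
apply: (he _ _ (- dotr (emb R m) u, - dotr (emb R m) x)); rewrite ?oppr_gt0//.
  by rewrite lexx ltW.
apply: (map_f (fun m => (- dotr (emb R m) u, - dotr (emb R m) x))).
by apply/flatten_mapP; exists s => //; apply/csP.
Qed.

Definition full_cone s := forall m : 'rV[R]_n, (forall u, s u -> dotr m u = 0) -> m = 0.

(* A cone meeting a generic ray from [u] in a segment is full-dimensional. *)
Lemma full_cone_at (u : 'rV[R]_n) : exists s, [/\ X s, full_cone s & s u].
Proof.
have [cs [gen [ms [csP _ _]]]] := fan_data.
have [nu hnu] : exists nu : set 'rV[R]_n -> 'rV[R]_n, forall s, ~ full_cone s ->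
    nu s != 0 /\ forall u, s u -> dotr (nu s) u = 0.
  suff /choice[nu] : forall s, exists m, ~ full_cone s ->
    m != 0 /\ forall u, s u -> dotr m u = 0 by exists nu.
  move=> s; have [f|nf] := pselect (full_cone s); first by exists 0.
  apply: contrapT => hn; apply: nf => m hm; apply: contrapT => /eqP m0.
  by apply: hn; exists m.
have [x hx] := generic [seq nu s | s <- cs].
have [s [Xs su [d d0 sd]]] := local_cone u x.
exists s; split=> //; apply: contrapT => /hnu[n0 ns].
have := hx (nu s) (map_f nu (proj1 (csP s) Xs)) n0.
by have := ns _ sd; rewrite dotrDr dotrZr ns// add0r => /eqP; rewrite mulf_eq0 gt_eqF//= => ->.
Qed.

(** The form cutting out the common face inside s' vanishes on s, hence is zero. *)
Lemma full_maximal s : X s -> full_cone s -> maximal_cone X s.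
Proof.
move=> Xs fs; split=> // s' Xs' ss'.
have [_ [m _ e]] := fan_inter Xs Xs'.
have m0 : m = 0.
  apply: fs => u su; have : (s `&` s')%classic u by split=> //; apply: ss'.
  by rewrite e => -[_ mu]; apply: mu.
apply/seteqP; split=> // u s'u; have : (s' `&` [set u | dot m u = 0])%classic u.
  by split=> //=; rewrite m0 dotE dot0r.
by rewrite -e => -[].
Qed.

(** The sum of the generators of s is in its relative interior, so a face of s containing it is all
    of s. *)
Lemma sub_full_cone s : X s -> exists s', [/\ X s', full_cone s' & (s `<=` s')%classic].
Proof.
move=> Xs; have [cs [gen [ms [_ hgen _]]]] := fan_data.
have sg u : u \in gen s -> s (emb R u) by move=> h; rewrite (hgen s)//; apply: hull_mem.
pose u := \sum_(x <- gen s) emb R x.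
have su : s u.
  by rewrite (hgen s)//; rewrite /u big_seq; apply: hull_sum => x; apply: hull_mem.
have [s' [Xs' fs' s'u]] := full_cone_at u; exists s'; split=> // v sv.
have [[m md e] _] := fan_inter Xs Xs'.
have : (s `&` s')%classic u by []; rewrite e => -[_ /= mu].
suff : (s `&` s')%classic v by case.
rewrite e; split=> //=; move: sv; rewrite (hgen s)//; apply: hull_eq0 => x xg.
move: mu; rewrite dotE dotr_sumr big_seq => /eqP.
rewrite psumr_eq0 => [|y yg]; last by apply: md; apply: sg.
by move=> /allP /(_ x xg); rewrite xg => /eqP.
Qed.

Lemma loc_agree (L : line_bundle X) s s' u : X s -> X s' -> s u -> s' u ->
  dotr (emb R (L s)) u = dotr (emb R (L s')) u.
Proof.
move=> Xs Xs' su s'u; have Xt := fan_setI Xs Xs'.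
have h1 : (s `&` s' `<=` s)%classic by move=> x [].
have h2 : (s `&` s' `<=` s')%classic by move=> x [].
have := loc_compat L Xs Xt h1 (conj su s'u).
by have := loc_compat L Xs' Xt h2 (conj su s'u); rewrite !dotE => -> ->.
Qed.

(* The support function of L is concave along the segment from an interior point
   of [s0] to [u], since each crossing of a cone is governed by [nef_step]. *)
Lemma nef_full (k : closedFieldType) (L : line_bundle X) s0 s1 (u : 'rV[int]_n) :
  nef k L -> X s0 -> full_cone s0 -> X s1 -> s1 (emb R u) ->
  dotr (L s1) u <= dotr (L s0) u.
Proof.
move=> nefL Xs0 f0 Xs1 s1u.
have [cs [gen [ms [csP hgen msP]]]] := fan_data.
(* An integral interior point of [s0], so that the direction [w] is integral as [nef_step]
   requires. *)
pose x : 'rV[int]_n := \sum_(g <- gen s0) g; pose w := u - x.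
pose y (t : R) := emb R x + t *: emb R w.
have y1 : y 1 = emb R u by rewrite /y scale1r -embD addrC subrK.
have yD a b : y (a + b) = y a + b *: emb R w by rewrite /y scalerDl addrA.
(* Induction on the number of cones still met after time b; s contains the segment from b to b +
   e. *)
have walk N : forall (b e : R) s, 0 <= b -> 0 < e -> b + e <= 1 -> X s -> s (y b) -> s (y (b + e)) ->
    (count (fun c : set 'rV[R]_n => `[< exists2 t : R, (b < t <= 1)%R & c (y t) >]) cs < N)%N ->
    dotr (L s1) u <= dotr (L s) u.
  elim: N => // N IH b e s b0 e0 be Xs sb sbe cN.
  have [su|nsu] := pselect (s (emb R u)).
    by rewrite -(ler_int R) -!dotr_emb (loc_agree L Xs Xs1 su).
  pose S := [seq (dotr (emb R m) (emb R x), dotr (emb R m) (emb R w)) | m <- ms s].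
  have SP t : s (y t) <-> forall p, p \in S -> 0 <= p.1 + t * p.2.
    split=> [/(msP _ Xs) h p /mapP[m mm ->]|h]; first by rewrite /= -dotrZr -dotrDr; apply: h.
    apply/(msP _ Xs) => m mm; rewrite dotrDr dotrZr.
    by apply: (h (dotr (emb R m) (emb R x), dotr (emb R m) (emb R w))); apply/mapP; exists m.
  have b1 : b <= 1 by lra.
  have [b' [/andP[bb' b'1] /SP sb' hn]] := segment_exit b1 (proj1 (SP b) sb).
  have beb' : b + e <= b'.
    by rewrite leNgt; apply/negP => lt; apply: (hn (b + e)); rewrite ?lt//; apply/SP.
  have {}b'1 : b' < 1.
    by rewrite lt_neqAle b'1 andbT; apply: contra_notN nsu => /eqP b'1'; rewrite -y1 -b'1'.
  (* The cone entered when the segment leaves s at time b'. *)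
  have [s' [Xs' s'b' [d d0 s'd]]] := local_cone (y b') (emb R w).
  have le : dotr (L s') w <= dotr (L s) w.
    apply: (@nef_step R k n X L s s' w (y b') d (b' - b)) => //; first by lra.
    have -> : y b' - (b' - b) *: toR R w = y b; last by [].
    by rewrite -scaleNr -(yD b' (- (b' - b))); congr y; ring.
  pose d' := Num.min d (1 - b').
  have d'0 : 0 < d' by rewrite lt_min d0 subr_gt0.
  have d'1 : b' + d' <= 1.
    have : d' <= 1 - b' by rewrite ge_min lexx orbT.
    lra.
  have s'd' : s' (y (b' + d')).
    have dd : d' <= d by rewrite ge_min lexx.
    have -> : y (b' + d') = (1 - d' / d) *: y b' + (d' / d) *: (y b' + d *: emb R w).
      rewrite yD; move: (y b') => z.
      by rewrite scalerDr scalerA divfK ?gt_eqF// addrA -scalerDl subrK scale1r.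
    apply: cone_convex => //; last by rewrite divr_ge0 ?ltW.
    by rewrite subr_ge0 ler_pdivrMr// mul1r.
  have h := IH b' d' s'; apply: le_trans (h _ _ _ _ _ _ _) _ => //; first by lra.
    (* The count drops because s is met at b + e but never after b'. *)
    rewrite -ltnS; apply: leq_trans cN; rewrite ltnS.
    have incl (c : set 'rV[R]_n) : (exists2 t, b' < t <= 1 & c (y t)) ->
        exists2 t, b < t <= 1 & c (y t).
      move=> [t /andP[t1 t2] ct]; exists t => //.
      by rewrite t2 andbT; apply: le_lt_trans t1.
    have scs : s \in cs by apply/csP.
    elim: (cs) scs => // c cs' IHc; rewrite inE => /predU1P[<-|/IHc lt] /=.
      rewrite (asboolT (P := exists2 t, b < t <= 1 & s (y t))); last first.
        by exists (b + e) => //; rewrite be ltrDl e0.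
      rewrite (asboolF (P := exists2 t, b' < t <= 1 & s (y t))).
        by rewrite add0n add1n ltnS; apply: sub_count => c' /asboolP/incl/asboolP.
      by case=> t bt /SP st; apply: (hn t).
    rewrite -addnS leq_add//.
    by case: (asboolP (exists2 t, b' < t <= 1 & c (y t))) => // /incl h'; rewrite (asboolT h').
  (* The data of s and s' agree at y b', and along the remaining (1 - b') w they compare by
     [nef_step]. *)
  rewrite -(ler_int R) -!dotr_emb.
  have -> : emb R u = y b' + (1 - b') *: emb R w by rewrite -y1 -yD; congr y; ring.
  have aux (z v v' : 'rV[R]_n) c : dotr z (v + c *: v') = dotr z v + c * dotr z v'.
    by rewrite dotrDr dotrZr.
  rewrite 2!(aux _ (y b')) (loc_agree L Xs Xs' sb' s'b') lerD2l ler_wpM2l ?subr_ge0 ?(ltW b'1)//.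
  by rewrite !dotr_emb ler_int.
have [e e0 he] := small [seq (dotr (emb R m) (emb R x), dotr (emb R m) (emb R w)) | m <- ms s0].
have sg g : g \in gen s0 -> s0 (emb R g) by move=> h; rewrite (hgen s0)//; apply: hull_mem.
have sx : s0 (emb R x).
  by rewrite (hgen s0)// /x emb_sum big_seq; apply: hull_sum => g; apply: hull_mem.
pose e1 := Num.min e 1.
have e10 : 0 < e1 by rewrite lt_min e0 ltr01.
apply: (walk _ 0 e1 s0) (ltnSn _) => //.
- by rewrite add0r ge_min lexx orbT.
- by rewrite /y scale0r addr0.
- rewrite add0r; apply/(msP _ Xs0) => m mm; rewrite dotrDr dotrZr.
  have mg g : g \in gen s0 -> 0 <= dotr (emb R m) (emb R g).
    by move=> /sg /(msP _ Xs0); apply.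
  have [mx|mx] := ltP 0 (dotr (emb R m) (emb R x)).
    apply/ltW/(he _ _ (dotr (emb R m) (emb R x), dotr (emb R m) (emb R w))) => //.
      by rewrite ltW//= ge_min lexx.
    by apply/mapP; exists m.
  (* A form nonnegative on the generators but not positive at their sum vanishes on all of [s0],
     which is full-dimensional. *)
  rewrite (_ : emb R m = 0) ?dot0r ?mulr0 ?addr0//.
  apply: f0 => v; rewrite (hgen s0)//; apply: hull_eq0 => g gg.
  have : \sum_(g <- gen s0) dotr (emb R m) (emb R g) == 0.
    by rewrite -dotr_sumr -emb_sum eq_le mx emb_sum dotr_sumr big_seq sumr_ge0.
  rewrite big_seq psumr_eq0 // => /allP /(_ g gg); rewrite gg /= => /eqP//.
Qed.

End Fan.

(** * Sections *)

Section Laurent.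
Variables (k : closedFieldType) (n : nat).
Notation M := 'rV[int]_n.
Implicit Types f g : M -> k.

Lemma chiE (m x : M) : chi k m x = if x == m then 1 else 0.
Proof. by rewrite /chi; case: eqP. Qed.

Lemma chi_neq0 (m x : M) (c : k) : c * chi k m x != 0 -> x = m.
Proof. by rewrite chiE; case: ifP => [/eqP|_]; rewrite ?mulr0 ?eqxx. Qed.

Lemma laurent_chi (m : M) (c : k) : laurent (fun x => c * chi k m x).
Proof.
apply: (sub_finite_set _ (finite_set1 m)) => x /=.
exact: chi_neq0.
Qed.

Lemma laurent0 : laurent (fun _ : M => 0 : k).
Proof. by apply: (sub_finite_set _ (finite_set0 M)) => x /=; rewrite eqxx. Qed.

Lemma lmul_chil (a : M) (c : k) g m :
  lmul (fun x => c * chi k a x) g m = c * g (m - a).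
Proof.
rewrite /lmul (@fsbigE _ _ _ _ _ [:: a]) //=.
  by rewrite big_cons big_nil ifT ?inE// addr0 chiE eqxx mulr1.
by move=> x _; rewrite inE chiE => /negPf ->; rewrite mulr0 mul0r.
Qed.

Lemma lmul_neq0 f g m : lmul f g m != 0 -> exists a, f a != 0 /\ g (m - a) != 0.
Proof.
move=> h; apply: contrapT => hn; move/eqP: h; apply.
rewrite /lmul fsbig1// => a _; apply/eqP; rewrite mulf_eq0; apply/negPn.
by rewrite negb_or; apply/negP => /andP[fa ga]; apply: hn; exists a.
Qed.

End Laurent.

Section Final.
Variables (R : realType) (k : closedFieldType) (n : nat) (X : fan R n).
Hypothesis Xcomplete : complete_fan X.

Lemma polytope_H0 (L : line_bundle X) (f : 'rV[int]_n -> k) :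
  H0 L f <-> laurent f /\ forall m, f m != 0 -> polytope L (toR R m).
Proof.
have E m s : toR R (m - L s) = toR R m - toR R (L s) by apply: embB.
split=> [[lf h]|[lf h]]; split=> //.
  by move=> m fm s Xs; rewrite -E; have [_ h'] := h s Xs; apply: h'.
by move=> s Xs; split=> // m fm; rewrite E; apply: h.
Qed.

(* A very ample power separates the maximal cones: its sections generate the
   coordinate ring of U_s, hence cut out s. *)
Lemma ample_strict (A : line_bundle X) s (u : 'rV[R]_n) :
  ample k A -> X s -> full_cone s ->
  polytope A (toR R (A s)) /\
  ((forall x, polytope A x -> dotr (toR R (A s)) u <= dotr x u) -> s u).
Proof.
move=> [r r0 va] Xs fs; have [chiH0 gen] := va s (full_maximal Xs fs).
have powE : forall s', tensor_pow A r s' = A s' *+ r.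
  by move=> s'; elim: (r) => //= i IH; rewrite /tensor_pow /= -/(tensor_pow A i) IH mulrS.
have r0' : 0 < r%:R :> R by rewrite ltr0n.
have PA x : polytope (tensor_pow A r) (toR R x) -> polytope A (r%:R^-1 *: toR R x).
  move=> h s' Xs' v s'v; have := h s' Xs' v s'v.
  rewrite !dotE powE [toR R (_ *+ r)](embMn R) !dotrBl dotrMnl dotrZl.
  by rewrite !subr_ge0 => h'; rewrite -(ler_pM2l r0') mulrA divff ?gt_eqF// mul1r mulr_natl.
split.
  have /polytope_H0[_ /(_ (tensor_pow A r s))] := chiH0.
  rewrite chiE eqxx oner_eq0 => /(_ isT)/PA; rewrite powE [toR R (_ *+ r)](embMn R).
  by rewrite -scaler_nat scalerA mulVf ?gt_eqF// scale1r.
move=> hmin; have [cs [gn [ms [_ _ msP]]]] := fan_data X.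
apply/(msP _ Xs) => m mm.
have chim : chart_sections (structure_sheaf X) s (chi k m).
  split; first by have := laurent_chi m (1 : k); congr laurent; apply/funext => x; rewrite mul1r.
  move=> x; rewrite -[chi _ _ _]mul1r => /chi_neq0-> v sv; rewrite subr0.
  by apply: (proj1 (msP _ Xs v) sv).
(* Functions supported in the half-space of u form an algebra. It contains the generators, as these
   are sections shifted by the vertex of s, which is minimal at u. *)
pose B := [set f : 'rV[int]_n -> k | forall x, f x != 0 -> 0 <= dotr (emb R x) u]%classic.
suff h : B (chi k m) by apply: h; rewrite chiE eqxx oner_neq0.
apply: (gen _ chim B).
- move=> _ [f /polytope_H0[_ fP] <-] x.
  have -> : chi k (- tensor_pow A r s) = (fun y => 1 * chi k (- tensor_pow A r s) y).
    by apply/funext => y; rewrite mul1r.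
  rewrite lmul_chil mul1r opprK => /fP /PA /hmin.
  have -> : toR R (x + tensor_pow A r s) = emb R x + emb R (A s) *+ r.
    by rewrite powE -embMn -embD.
  rewrite dotrZl -(ler_pM2l r0') mulrA divff ?gt_eqF// mul1r.
  by rewrite dotrDl dotrMnl mulr_natl lerDr.
- by move=> x; rewrite -[chi _ _ _]mul1r => /chi_neq0->; rewrite emb0 dot0r.
- move=> c g h gB hB x; have [gx|/gB//] := eqVneq (g x) 0.
  by rewrite gx mulr0 add0r => /hB.
- move=> g h gB hB x /lmul_neq0[y [/gB gy /hB hy]].
  by rewrite -[x](subrK y) embD dotrDl addr_ge0.
Qed.

(** The characters of the points of s, padded with zeros up to N, span the cokernel: every other
    monomial of a section is a product of two monomial sections. *)
Lemma coker_bound (L1 L2 : line_bundle X) (N : nat) (s : seq 'rV[int]_n) :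
  (size s <= N)%N -> (forall m, m \in s -> polytope (tensor L1 L2) (toR R m)) ->
  (forall m, polytope (tensor L1 L2) (toR R m) -> m \notin s -> exists x y,
    [/\ polytope L1 (toR R x), polytope L2 (toR R y) & m = x + y]) ->
  dim_coker_le k L1 L2 N.
Proof.
(* Repetitions are removed, as otherwise a coefficient would be subtracted more than once. *)
move=> sN sP good; pose s' := undup s.
have s'N : (size s' <= N)%N by apply: leq_trans sN; apply: size_undup.
pose b (i : 'I_N) : 'rV[int]_n -> k :=
  if (i < size s')%N then chi k (nth 0 s' i) else fun=> 0.
exists b.
  move=> i; apply/polytope_H0; rewrite /b; case: ifP => [is'|_]; last first.
    by split=> [|m]; [apply: laurent0|rewrite eqxx].
  split.
    have := laurent_chi (nth 0 s' i) (1 : k).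
    by congr laurent; apply/funext => x; rewrite mul1r.
  move=> m; rewrite -[chi _ _ _]mul1r => /chi_neq0->.
  by apply: sP; rewrite -mem_undup mem_nth.
move=> f /polytope_H0[lf fP].
exists (fun i => f (nth 0 s' i)); set g := fun m => _.
have gE m : g m = if m \in s then 0 else f m.
  rewrite /g; case: ifP => ms.
    have is' : (index m s' < size s')%N by rewrite index_mem mem_undup.
    have iN := leq_trans is' s'N.
    rewrite (bigD1 (Ordinal iN))//= /b is' nth_index ?mem_undup// chiE eqxx mulr1.
    rewrite big1 ?addr0 ?subrr// => j ji; case: ifP => js; last by rewrite mulr0.
    rewrite chiE; case: (m =P _) => [mj|]; last by rewrite mulr0.
    exfalso; move/eqP: ji; apply; apply: ord_inj => /=.
    by rewrite mj index_uniq ?undup_uniq.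
  rewrite big1 ?subr0// => j _; rewrite /b; case: ifP => js; last by rewrite mulr0.
  rewrite chiE; case: (m =P _) => [mj|]; last by rewrite mulr0.
  by move: ms; rewrite -mem_undup mj mem_nth.
have /finite_seqP[S' SE] : laurent g.
  by apply: sub_finite_set lf => m /=; rewrite gE; case: ifP; rewrite ?eqxx.
pose S := undup S'.
have SP m : m \in S = (g m != 0).
  rewrite mem_undup; apply/idP/idP => h.
    by have : [set` S']%classic m by []; rewrite -SE.
  by have : [set m | g m != 0]%classic m by []; rewrite SE.
have [xy hxy] : exists xy : 'rV[int]_n -> 'rV[int]_n * 'rV[int]_n, forall m, m \in S ->
    [/\ polytope L1 (toR R (xy m).1), polytope L2 (toR R (xy m).2) & m = (xy m).1 + (xy m).2].
  suff /choice[xy] : forall m, exists xy : 'rV[int]_n * 'rV[int]_n, m \in S ->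
    [/\ polytope L1 (toR R xy.1), polytope L2 (toR R xy.2) & m = xy.1 + xy.2] by exists xy.
  move=> m; case: (boolP (m \in S)) => [|_]; last by exists (0, 0).
  rewrite SP gE; case: ifP => [_|ms fm]; first by rewrite eqxx.
  have [x [y h]] := good m (fP m fm) (negbT ms); by exists (x, y).
have memS (j : 'I_(size S)) : S`_j \in S by rewrite mem_nth.
exists (size S), (fun j x => g S`_j * chi k (xy S`_j).1 x), (fun j x => 1 * chi k (xy S`_j).2 x).
have H0chi (L : line_bundle X) (c : k) x : polytope L (toR R x) ->
    H0 L (fun y => c * chi k x y).
  move=> xL; apply/polytope_H0; split; first exact: laurent_chi.
  by move=> m /chi_neq0->.
split=> [j|j|m].
- by apply: H0chi; case: (hxy _ (memS j)).
- by apply: H0chi; case: (hxy _ (memS j)).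
have E (j : 'I_(size S)) : lmul (fun x => g S`_j * chi k (xy S`_j).1 x)
    (fun x => 1 * chi k (xy S`_j).2 x) m = if m == S`_j then g m else 0.
  rewrite lmul_chil mul1r chiE; have [_ _ e] := hxy _ (memS j).
  rewrite -subr_eq0 -addrA -opprD -e subr_eq0.
  by case: (m =P _) => [->|]; rewrite ?mulr1 ?mulr0.
rewrite (eq_bigr _ (fun j _ => E j)).
have [mS|mS] := boolP (m \in S); last first.
  have gm : g m = 0 by apply/eqP; rewrite -[_ == _]negbK -SP.
  by rewrite gm big1// => j _; case: ifP.
have iS : (index m S < size S)%N by rewrite index_mem.
rewrite (bigD1 (Ordinal iS))//= nth_index// eqxx big1 ?addr0// => j ji.
case: (m =P _) => // mj; exfalso; move/eqP: ji; apply; apply: ord_inj => /=.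
by rewrite mj index_uniq ?undup_uniq.
Qed.

End Final.

Theorem theorem1 (R : realType) (k : closedFieldType) (n : nat) (X : fan R n)
    (hproj : projective k X) (hgen : general k X) :
  exists N : nat, forall L1 L2 : line_bundle X,
    nef k L1 -> nef k L2 -> dim_coker_le k L1 L2 N.
Proof.
case: hproj => Xc _; case: hgen => A ampA noparA.
have [cs [gen [ms [csP hgen _]]]] := fan_data X.
(* Bundles are recorded by their data on the full-dimensional cones alone. *)
pose fs := [seq s <- cs | `[< full_cone s >]].
pose C (i : 'I_(size fs)) := tnth (in_tuple fs) i; pose G i := gen (C i).
have CP i : X (C i) /\ full_cone (C i).
  have : C i \in fs by exact: mem_tnth.
  by rewrite mem_filter => /andP[/asboolP ? /csP].
have GC i : C i = hull (G i) by apply: hgen; case: (CP i).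
have fullC s : X s -> full_cone s -> exists i, s = C i.
  move=> Xs fs'; have sfs : s \in fs by rewrite mem_filter asboolT//=; apply/csP.
  have is' : (index s fs < size fs)%N by rewrite index_mem.
  by exists (Ordinal is'); rewrite /C (tnth_nth s) /= nth_index.
have complete (u : 'rV[R]_n) : exists i, hull (G i) u.
  have [s [Xs fs' su]] := full_cone_at Xc u.
  by have [i e] := fullC s Xs fs'; exists i; rewrite -GC -e.
have memG i u : u \in G i -> C i (emb R u) by rewrite GC; apply: hull_mem.
have full i (m : 'rV[int]_n) : (forall u, u \in G i -> dotr m u = 0) -> m = 0.
  move=> h; apply: (@emb_inj R); rewrite emb0; case: (CP i) => _; apply=> u.
  by rewrite GC; apply: hull_eq0 => x /h mx; rewrite dotr_emb mx.
pose dat (L : line_bundle X) : {ffun 'I_(size fs) -> 'rV[int]_n} := [ffun i => L (C i)].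
(* Every cone lies in a full-dimensional one with compatible data, so the inequalities there
   suffice. *)
have polyE L x : polytope L x <-> inPF G (dat L) x.
  split=> [h i u ui|h s Xs u su].
    have := h _ (CP i).1 _ (memG i u ui).
    by rewrite dotE dotrBl subr_ge0 ffunE.
  have [s' [Xs' fs' ss']] := sub_full_cone Xc Xs; have [i e] := fullC s' Xs' fs'.
  have hu : hull (G i) u by rewrite -GC -e; apply: ss'.
  have := inPF_hull h hu; rewrite ffunE dotE dotrBl subr_ge0; congr (_ <= _).
  by apply: loc_agree; rewrite -?e//; apply: ss'.
have nefE L : nef k L -> nefd G (dat L).
  move=> nL i j u ui; rewrite !ffunE.
  by apply: (nef_full Xc nL); [case: (CP j)|case: (CP j)|case: (CP i)|exact: memG].
have nefA : nefd G (dat A).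
  apply/nefd_inP => i; apply/(@inP_emb _ _ _ R)/polyE; rewrite ffunE.
  by have [] := ample_strict 0 ampA (CP i).1 (CP i).2.
have strictA i (u : 'rV[R]_n) :
    (forall j, dotr (emb R (dat A i)) u <= dotr (emb R (dat A j)) u) -> hull (G i) u.
  move=> h; rewrite -GC; apply: (ample_strict u ampA (CP i).1 (CP i).2).2 => x /polyE xP.
  (* Minimality among the vertices gives minimality on the polytope, since u lies in some cone j, on
     which the vertex j is minimal. *)
  have [j hj] := complete u; apply: le_trans (inPF_hull xP hj).
  by have := h j; rewrite ffunE.
have noparA' : no_parallel_edges [set x : 'rV[R]_n | inPF G (dat A) x]%classic.
  by rewrite (_ : mkset _ = polytope A)//; apply/seteqP; split=> x /polyE.
have cone_of := single_cone complete nefA strictA noparA'.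
have [N hN] := bounded_nonsplit complete full cone_of.
exists N => L1 L2 /nefE n1 /nefE n2; have [s [sN sP hs]] := hN _ _ n1 n2.
have datT : dat (tensor L1 L2) = dat L1 + dat L2 by apply/ffunP => i; rewrite !ffunE.
apply: (coker_bound k sN) => [m /sP|m /polyE].
  by move=> mP; apply/polyE/inP_emb; rewrite datT.
rewrite datT => /inP_emb mP mns.
have : good G (dat L1) (dat L2) m by apply: contrapT => /(hs m mP); apply/negP.
move=> [x [y [xP yP e]]]; exists x, y.
by split=> //; apply/polyE/inP_emb.
Qed.
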